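(* Let $0<q<1$, $t>0$ with $tq<1$, and $k\in\mathbb{N}$. The following identity holds: $$\sum_{N=1}^\infty\sum_\lambda N\,F_{N,k}(\lambda)\,(1-q)^{N^2}\,q^{|\lambda|}\,(tq)^{N-1}\,s_\lambda(1^N)^2=\frac{q^k\,k!}{(1-q)^k(1-tq)^{k+2}}\;{}_2F_1\left(\begin{matrix}-k,-k\\ 1\end{matrix};t\right),$$ where the inner sum is over all integer partitions $\lambda$ (the terms with $\lambda$ having more than $N$ parts being $0$, since then $s_\lambda(1^N)=0$).
   Context: Conventions: $\mathbb{N}=\{0,1,2,\dots\}$; an empty product is $1$. For an integer partition $\lambda$, $|\lambda|=\sum_i\lambda_i$; $s_\lambda(x_1,\dots,x_N)$ is the Schur polynomial in $N$ variables, and $s_\lambda(1^N)=s_\lambda(1,\dots,1)$ ($N$ ones). For $\lambda$ with at most $N$ parts (padded by zeros to length $N$), $$F_{N,k}(\lambda)=\frac1N\sum_{i=1}^N(\lambda_i+N-i)(\lambda_i+N-i-1)\cdots(\lambda_i+N-i-k+1).$$ Hypergeometric notation: $(a)_i=a(a+1)\cdots(a+i-1)$ and ${}_2F_1\left(\begin{matrix}a,b\\ c\end{matrix};z\right)=\sum_{i\ge0}\frac{(a)_i(b)_i}{(c)_i}\frac{z^i}{i!}$, which terminates if $a$ or $b$ is a nonpositive integer. *)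

(* Defs.v *)
From mathcomp Require Import all_boot all_order all_algebra.
From mathcomp Require Import all_classical all_reals all_analysis.

Set Implicit Arguments.
Unset Strict Implicit.
Unset Printing Implicit Defensive.

Import Order.TTheory GRing.Theory Num.Theory.
Import numFieldNormedType.Exports.

Local Open Scope ring_scope.

(* Partitions are stored without trailing zeros, so that each partition has
   exactly one representative; |la| is [sumn la], and the (i+1)-st part, padded
   by zeros, is [nth 0 la i]. *)
Definition is_partition (la : seq nat) : bool :=
  sorted geq la && (0%N \notin la).

(* A cell is a pair (row, column), both counted from 0. *)
Notation cell la := {i : 'I_(size la) & 'I_(nth 0%N la i)}.

Definition cell_row (la : seq nat) (c : cell la) : nat := tag c.
Definition cell_col (la : seq nat) (c : cell la) : nat := tagged c.

Definition semistandard (la : seq nat) (N : nat)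
    (T : {ffun cell la -> 'I_N}) : bool :=
  [forall c, forall d,
     ((cell_row c == cell_row d) && (cell_col c <= cell_col d)%N
        ==> (T c <= T d)%N)
  && ((cell_col c == cell_col d) && (cell_row c < cell_row d)%N
        ==> (T c < T d)%N)].

(* The value s_la(x_0, ..., x_{N-1}), as the generating function of
   semistandard Young tableaux of shape la with entries in {0, ..., N-1}; when
   la has more than N parts there is no such tableau and the value is 0. *)
Definition schur (R : comNzRingType) (la : seq nat) (N : nat)
    (x : 'I_N -> R) : R :=
  \sum_(T : {ffun cell la -> 'I_N} | semistandard T) \prod_(c : cell la) x (T c).

(* F_{N,k}(la). With i counted from 0, la_i + N - i becomes
   [nth 0 la i + (N - i.+1)], where i < N makes the subtraction exact. *)
Definition part_moment (R : realType) (N k : nat) (la : seq nat) : R :=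
  N%:R^-1 * \sum_(i < N) ((nth 0%N la i + (N - i.+1)) ^_ k)%:R.

Definition rising_fact (R : realType) (a : R) (i : nat) : R :=
  \prod_(j < i) (a + j%:R).

Definition hyp2F1 (R : realType) (a b c z : R) : R :=
  limn (series (fun i : nat =>
    rising_fact a i * rising_fact b i / rising_fact c i * (z ^+ i / i`!%:R))).

(* Main.v *)
(** Write [N] for the number of variables, [h_i = la_i + N - i] and [x = t q].
    Branching over the largest entry of a tableau gives
    [s_la(1^N) = det (binomial (h_i) (N - j))], so the inner sum is the expectation of
    [sum_i f (h_i)] in an orthogonal polynomial ensemble with weight [q ^ h]. After
    column operations the determinant is that of the Meixner polynomials [P_n], with
    [sum_n P_n(h) z ^ n = (1 - z) ^ h / (1 - q z) ^ h.+1], and Cauchy-Binet reduces the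
    inner sum to the diagonal entries of [A_k(n, m) = sum_h C(h, k) P_n(h) P_m(h) q ^ h].
    The relation [P_n(h+1) - q P_(n-1)(h+1) = P_n(h) - P_(n-1)(h)] and the shift
    [h -> h + 1] determine [A_k] recursively: [A_k(n, m)] is the coefficient of
    [z ^ n w ^ m] in [q ^ k ((1 - z) (1 - w)) ^ k / ((1 - q) (1 - q z w)) ^ k.+1].
    Divided by [q ^ n], its diagonal is a convolution of [C(k, i) ^ 2 q ^ (- i)] with the
    coefficients of [(1 - z) ^ (- k.+1)]; summing over [n < N] and then over [N]
    raises the exponent to [k + 2] and yields [sum_i C(k, i) ^ 2 t ^ i / (1 - x) ^ k.+2]. *)

Require Import Defs.
From mathcomp Require Import all_boot all_order all_algebra all_fingroup.
From mathcomp Require Import all_classical all_reals all_analysis.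
From mathcomp Require Import zify ring.

Set Implicit Arguments.
Unset Strict Implicit.
Unset Printing Implicit Defensive.

Import Order.TTheory GRing.Theory Num.Theory.
Import numFieldNormedType.Exports.

Local Open Scope classical_set_scope.
Local Open Scope ring_scope.

(** * Cauchy-Binet with an inserted statistic *)

(** Multilinearity in the rows: the product in each Leibniz term is distributed over all choices [f]
    of one summand per row. *)
Lemma det_sum_rows (R : comNzRingType) (N : nat) (T : finType)
    (Q : 'I_N -> pred T) (F : 'I_N -> T -> 'I_N -> R) :
  \det (\matrix_(i, j) \sum_(x | Q i x) F i x j)
  = \sum_(f in family Q) \det (\matrix_(i, j) F i (f i) j).
Proof.
rewrite /determinant exchange_big /=; apply: eq_bigr => s _.
rewrite -big_distrr /=; congr (_ * _).
under eq_bigr do rewrite mxE.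
rewrite bigA_distr_big_dep; apply: eq_bigr => f _.
by apply: eq_bigr => i _; rewrite mxE.
Qed.

(** Such sequences encode partitions with at most [N] parts, through [h_i = la_i + N - i - 1]; [M]
    is a cutoff that later tends to infinity. *)
Definition decreasing_ffun (N M : nat) (s : {ffun 'I_N -> 'I_M}) : bool :=
  [forall i : 'I_N, forall j : 'I_N, (i < j)%N ==> (s j < s i)%N].

Lemma decreasing_ffunP (N M : nat) (s : {ffun 'I_N -> 'I_M}) :
  reflect (forall i j : 'I_N, (i < j)%N -> (s j < s i)%N) (decreasing_ffun s).
Proof.
apply: (iffP forallP) => [H i j ij|H i]; first by move/forallP/(_ j)/implyP: (H i); apply.
by apply/forallP => j; apply/implyP/H.
Qed.

Lemma decreasing_ffun_inj (N M : nat) (s : {ffun 'I_N -> 'I_M}) :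
  decreasing_ffun s -> injective s.
Proof.
move/decreasing_ffunP => H i j sij; apply/val_inj => /=.
by case: (ltngtP i j) => // /H; rewrite sij ltnn.
Qed.

(** In decreasing order, the position of an entry is the number of larger entries; hence [p0] can
    only be the inverse of the rank permutation. *)
Lemma decreasing_reordering (N M : nat) (h : {ffun 'I_N -> 'I_M}) :
  injective h ->
  exists p0 : 'S_N, forall p : 'S_N,
    decreasing_ffun [ffun i => h (p i)] = (p == p0).
Proof.
move=> hI.
pose r x := #|[set j | (h x < h j)%N]%SET|.
have r_lt x : (r x < N)%N.
  rewrite -[X in (_ < X)%N]card_ord -cardsT; apply: proper_card.
  by rewrite properT; apply/eqP => /setP/(_ x); rewrite !inE ltnn.
have r_mono x y : (h x < h y)%N -> (r y < r x)%N.
  move=> xy; apply: proper_card; apply/properP; split.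
    by apply/fintype.subsetP => j; rewrite !inE; apply: ltn_trans.
  by exists y; rewrite !inE ?ltnn.
have rE x y : (r y < r x)%N = (h x < h y)%N.
  case: (ltngtP (h x) (h y)) => [/r_mono //|/r_mono|/val_inj/hI ->].
    by move=> yx; apply/negbTE; rewrite -leqNgt ltnW.
  by rewrite ltnn.
have rI : injective (fun x => Ordinal (r_lt x)).
  move=> x y [] rxy; apply/hI/val_inj => /=.
  by case: (ltngtP (h x) (h y)) => // /r_mono; rewrite rxy ltnn.
exists (perm rI)^-1%g => p; apply/idP/eqP => [/decreasing_ffunP H|->].
  apply/permP => i; apply: (perm_inj (s := perm rI)); rewrite permKV permE.
  (* Pulled back along [p], the entries larger than [h (p i)] occupy exactly the positions before
     [i]. *)
  apply/val_inj => /=; rewrite /r -(card_imset _ (@perm_inj _ p^-1%g)).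
  transitivity #|[set j : 'I_N | (j < i)%N]%SET|; last first.
    rewrite -sum1dep_card -(big_ord_widen _ (fun=> 1%N)) ?sum1_card ?card_ord //.
    exact: ltnW.
  apply: eq_card => j; rewrite inE.
  apply/imsetP/idP => [[x]|ji].
    rewrite inE => hx ->.
    rewrite ltnNge; apply/negP; rewrite leq_eqVlt => /orP[/eqP/val_inj E|/H].
      by move: hx; rewrite E permKV ltnn.
    by rewrite !ffunE permKV => /(ltn_trans hx); rewrite ltnn.
  by exists (p j); rewrite ?permK // inE; have := H _ _ ji; rewrite !ffunE.
apply/decreasing_ffunP => i j ij; rewrite !ffunE -rE.
have re k : r ((perm rI)^-1%g k) = k.
  by have := permKV (perm rI) k; rewrite permE => /(congr1 val).
by rewrite !re.
Qed.

(** An injective sequence is a decreasing one composed with a permutation, in exactly one way. *)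
Lemma sum_injective_ffun (V : nmodType) (N M : nat)
    (G : {ffun 'I_N -> 'I_M} -> V) :
  \sum_(h : {ffun 'I_N -> 'I_M} | injectiveb h) G h
  = \sum_(s : {ffun 'I_N -> 'I_M} | decreasing_ffun s)
      \sum_(p : 'S_N) G [ffun i => s (p i)].
Proof.
transitivity (\sum_(h : {ffun 'I_N -> 'I_M} | injectiveb h)
    \sum_(p : 'S_N | decreasing_ffun [ffun i => h (p i)]) G h).
  apply: eq_bigr => h /injectiveP/decreasing_reordering[p0 p0P].
  by under eq_bigl do rewrite p0P; rewrite big_pred1_eq.
rewrite (exchange_big_dep xpredT) //= [RHS]exchange_big /= (reindex_inj invg_inj).
apply: eq_bigr => p _.
rewrite (reindex (fun s : {ffun 'I_N -> 'I_M} => [ffun i => s (p i)])) /=; last first.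
  exists (fun s : {ffun 'I_N -> 'I_M} => [ffun i => s (p^-1%g i)]) => s _.
    by apply/ffunP => i; rewrite !ffunE permKV.
  by apply/ffunP => i; rewrite !ffunE permK.
apply: eq_bigl => s.
have -> : [ffun i => [ffun i => s (p i)] (p^-1%g i)] = s.
  by apply/ffunP => i; rewrite !ffunE permKV.
apply/andb_idl => /decreasing_ffun_inj sI.
by apply/injectiveP => i j; rewrite !ffunE => /sI/perm_inj.
Qed.

(** Both sides are the sum of [G h] over all sequences [h], where one determinant is reduced to its
    diagonal product. Multilinearity in the rows gives the right side, the factor [f] being attached
    to one row [m] at a time; grouping [h] by its decreasing reordering rebuilds the missing
    determinant on the left. *)
Lemma cauchy_binet_insertion (R : comNzRingType) (N M : nat)
    (phi : 'I_N -> 'I_M -> R) (f w : 'I_M -> R) :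
  \sum_(s : {ffun 'I_N -> 'I_M} | decreasing_ffun s)
     (\sum_i f (s i)) * (\prod_i w (s i)) * \det (\matrix_(i, j) phi j (s i)) ^+ 2
  = \sum_m \det (\matrix_(i, j)
      \sum_x (if i == m then f x else 1) * w x * phi i x * phi j x).
Proof.
pose G (h : {ffun 'I_N -> 'I_M}) := (\sum_i f (h i)) * (\prod_i w (h i))
  * (\prod_i phi i (h i)) * \det (\matrix_(i, j) phi j (h i)).
transitivity (\sum_(h : {ffun 'I_N -> 'I_M}) G h); last first.
  transitivity (\sum_(h : {ffun 'I_N -> 'I_M}) \sum_m \det (\matrix_(i, j)
     ((if i == m then f (h i) else 1) * w (h i) * phi i (h i) * phi j (h i)))).
    apply: eq_bigr => h _; rewrite /G !mulr_suml; apply: eq_bigr => m _.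
    have -> : \matrix_(i, j) ((if i == m then f (h i) else 1) * w (h i)
         * phi i (h i) * phi j (h i))
       = diag_mx (\row_i ((if i == m then f (h i) else 1) * w (h i) * phi i (h i)))
         *m \matrix_(i, j) phi j (h i).
      by apply/matrixP => i j; rewrite mul_diag_mx !mxE.
    rewrite det_mulmx det_diag; congr (_ * _).
    under [RHS]eq_bigr do rewrite mxE.
    rewrite !big_split /=; congr (_ * _ * _).
    by rewrite -big_mkcond /= big_pred1_eq.
  rewrite exchange_big; apply: eq_bigr => m _.
  rewrite det_sum_rows; apply: eq_bigl => h.
  by apply/esym/familyP => i.
(* A repeated value in [h] makes two rows equal, so only injective sequences contribute. *)
rewrite [RHS](bigID (fun h : {ffun 'I_N -> 'I_M} => injectiveb h)) /=.
rewrite [X in _ + X]big1 ?addr0; last first.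
  move=> h /injectivePn[i [j ij hij]]; rewrite /G.
  rewrite [\det _](determinant_alternate ij) ?mulr0 // => k.
  by rewrite !mxE hij.
rewrite sum_injective_ffun; apply: eq_bigr => s _.
set D := \det _.
(* Reordering by [p] fixes the symmetric factors and multiplies the determinant by the sign of [p];
   with the diagonal product this sign forms one Leibniz term of the second determinant. *)
have GE (p : 'S_N) : G [ffun i => s (p i)] = (\sum_i f (s i)) * (\prod_i w (s i)) * D
    * ((-1) ^+ p * \prod_i (\matrix_(i, j) phi i (s j)) i (p i)).
  rewrite /G.
  have -> : \sum_i f ([ffun i => s (p i)] i) = \sum_i f (s i).
    by rewrite [RHS](reindex_inj (@perm_inj _ p)); apply: eq_bigr => i _; rewrite ffunE.
  have -> : \prod_i w ([ffun i => s (p i)] i) = \prod_i w (s i).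
    by rewrite [RHS](reindex_inj (@perm_inj _ p)); apply: eq_bigr => i _; rewrite ffunE.
  have -> : \matrix_(i, j) phi j ([ffun i => s (p i)] i)
      = row_perm p (\matrix_(i, j) phi j (s i)).
    by apply/matrixP => i j; rewrite !mxE ffunE.
  rewrite row_permE det_mulmx det_perm -/D.
  have -> : \prod_i phi i ([ffun i => s (p i)] i)
      = \prod_i (\matrix_(i, j) phi i (s j)) i (p i).
    by apply: eq_bigr => i _; rewrite mxE ffunE.
  by rewrite -!mulrA; congr (_ * (_ * _)); rewrite mulrC mulrAC mulrC.
under [RHS]eq_bigr do rewrite GE.
rewrite -mulr_sumr -/(\det _) expr2 mulrA; congr (_ * _).
by rewrite -det_tr /D; congr (\det _); apply/matrixP => i j; rewrite !mxE.
Qed.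

(** * Tableaux and the determinant of binomials *)

(** Extension by zero turns an interlacing sequence into a shape of the same kind as [nth 0 la]. *)
Definition ffun_ext (n K : nat) (m : {ffun 'I_n -> 'I_K}) (i : nat) : nat :=
  if insub i is Some j then m j else 0%N.

Lemma ffun_extE (n K : nat) (m : {ffun 'I_n -> 'I_K}) (i : 'I_n) :
  ffun_ext m i = m i.
Proof. by rewrite /ffun_ext valK. Qed.

(** Up to column operations and factorials, this is the Vandermonde matrix of the shifted parts, as
    in Weyl's dimension formula. *)
Definition bin_matrix (R : pzRingType) (n : nat) (l : nat -> nat) : 'M[R]_n :=
  \matrix_(i < n, j < n) ('C(l i + (n - i.+1), n - j.+1))%:R.

Lemma sum_bin_interval (a b j : nat) : (a <= b)%N ->
  (\sum_(a <= x < b) 'C(x, j) + 'C(a, j.+1) = 'C(b, j.+1))%N.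
Proof.
elim: b => [|b IH]; first by rewrite leqn0 => /eqP ->; rewrite big_geq.
rewrite leq_eqVlt => /orP[/eqP ->|]; first by rewrite big_geq.
by rewrite ltnS => ab; rewrite big_nat_recr //= addnAC IH // binS addnC.
Qed.

Lemma sum_bin_ord (K a b c j : nat) : (a <= b)%N -> (b <= K)%N ->
  (\sum_(m < K.+1 | (a <= m)%N && (m <= b)%N) 'C(m + c, j) + 'C(a + c, j.+1)
   = 'C((b + c).+1, j.+1))%N.
Proof.
move=> ab bK; rewrite -(@sum_bin_interval (a + c) (b + c).+1 j); last by lia.
congr (_ + _)%N.
rewrite -(addSn b c) big_addn addnK.
rewrite -(big_mkord (fun m => (a <= m)%N && (m <= b)%N) (fun m => 'C(m + c, j))).
rewrite (big_cat_nat (n := a)) //=; last by lia.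
rewrite [X in (X + _)%N]big_nat_cond [X in (X + _)%N]big1 ?add0n; last by move=> i; lia.
rewrite (big_cat_nat (n := b.+1)) //=; last by lia.
rewrite [X in (_ + X)%N]big_nat_cond [X in (_ + X)%N]big1 ?addn0; last by move=> i;  lia.
rewrite big_nat_cond [RHS]big_nat_cond; apply: eq_bigl => i; lia.
Qed.

(* Rows of the binomial matrix are partial sums, from the bottom, of the rows of
   [B], whose last column is zero except for its bottom entry. *)
Lemma det_bin_matrixS (R : comNzRingType) (K n : nat) (l : nat -> nat) :
  (forall i, (i < n)%N -> (l i.+1 <= l i)%N) -> (l 0%N <= K)%N ->
  \det (bin_matrix R n.+1 l) =
  \sum_(m : {ffun 'I_n -> 'I_K.+1} |
        [forall i : 'I_n, (l i.+1 <= m i)%N && (m i <= l i)%N])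
    \det (bin_matrix R n (ffun_ext m)).
Proof.
move=> ldec l0K.
have lK i : (i <= n)%N -> (l i <= K)%N.
  by elim: i => // i IH ilt; apply: leq_trans (ldec _ _) (IH _); lia.
pose A (i j : nat) : R := ('C(l i + (n - i), n - j))%:R.
pose B (i j : nat) : R := if (i == n)%N then A i j else A i j - A i.+1 j.
pose U : 'M[R]_n.+1 := \matrix_(i, j) (i <= j)%N%:R.
have -> : bin_matrix R n.+1 l = U *m (\matrix_(i, j) B i j).
  apply/matrixP => i j; rewrite !mxE !subSS -/(A i j).
  under eq_bigr do rewrite !mxE mulr_natl mulrb.
  rewrite -big_mkcond /=.
  rewrite -(big_mkord (fun k => (i <= k)%N) (fun k => B k j)).
  rewrite (big_cat_nat (n := i)) //=; last by rewrite ltnW.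
  rewrite [X in X + _]big_nat_cond [X in X + _]big1 ?add0r; last by move=> k; lia.
  rewrite big_nat_cond.
  rewrite (eq_bigl (fun k => (i <= k < n.+1)%N)); last by move=> k; lia.
  have ilen : (i <= n)%N by rewrite -ltnS.
  rewrite -big_nat big_nat_recr //= /B eqxx.
  rewrite (eq_big_nat _ _ (F2 := fun k => - (A k.+1 j - A k j))); last first.
    by move=> k /andP[_ kn]; rewrite ltn_eqF // opprB.
  by rewrite sumrN telescope_sumr // opprB addrNK.
rewrite det_mulmx.
have -> : \det U = 1.
  rewrite -det_tr det_trig; last first.
    by apply/is_trig_mxP => i j ij; rewrite !mxE leqNgt ij.
  by rewrite big1 // => i _; rewrite !mxE leqnn.
rewrite mul1r (expand_det_col _ ord_max) (bigD1 ord_max) //= [X in _ + X]big1 ?addr0; last first.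
  move=> i; rewrite -val_eqE /= => ni; rewrite mxE /B (negbTE ni) /A subnn !bin0.
  by rewrite subrr mul0r.
rewrite mxE /B eqxx /A subnn bin0 mul1r /cofactor /= addnn -mul2n exprM sqrrN !expr1n mul1r.
rewrite [RHS](_ : _ = \sum_(f in family (fun (i : 'I_n) (m : 'I_K.+1) =>
      (l i.+1 <= m)%N && (m <= l i)%N))
    \det (\matrix_(i < n, j < n) ('C(f i + (n - i.+1), n - j.+1))%:R : 'M[R]_n)); last first.
  apply: eq_big => [f|f _].
    by apply/forallP/familyP => H i; have := H i.
  congr (\det _); apply/matrixP => i j; by rewrite !mxE ffun_extE.
rewrite -(det_sum_rows _ (fun (i : 'I_n) (m : 'I_K.+1) (j : 'I_n) =>
    ('C(m + (n - i.+1), n - j.+1))%:R)).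
congr (\det _); apply/matrixP => i j.
have liftE (k : 'I_n) : lift ord_max k = k :> nat by rewrite lift_max.
(* By the hockey-stick identity, the difference of two consecutive rows is a sum over the values
   between [l i.+1] and [l i]; all rows together run over the sequences interlacing [l]. *)
have E : ('C(l i + (n - i), n - j) = \sum_(m < K.+1 | (l i.+1 <= m)%N && (m <= l i)%N)
    'C(m + (n - i.+1), n - j.+1) + 'C(l i.+1 + (n - i.+1), n - j))%N.
  have [e1 e2] : (n - j = (n - j.+1).+1 /\ n - i = (n - i.+1).+1)%N.
    by have := ltn_ord i; have := ltn_ord j; lia.
  by rewrite e1 e2 addnS sum_bin_ord ?ldec // lK // ltnW.
by rewrite 4!mxE !liftE /B ltn_eqF // /A E natrD addrK natr_sum.
Qed.

(* A tableau of shape [l] with entries below [n], completed by the value [B]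
   outside the shape. *)
Definition matrix_tableau (L C B n : nat) (l : nat -> nat)
    (T : {ffun 'I_L * 'I_C -> 'I_B.+1}) : bool :=
  `[< [/\ forall (i : 'I_L) (j : 'I_C), (j < l i)%N -> (T (i, j) < n)%N,
          forall (i : 'I_L) (j : 'I_C), (l i <= j)%N -> T (i, j) = ord_max,
          forall (i : 'I_L) (j j' : 'I_C), (j <= j')%N -> (T (i, j) <= T (i, j'))%N
        & forall (i i' : 'I_L) (j : 'I_C), (i < i')%N -> (j < l i')%N ->
            (T (i, j) < T (i', j))%N] >].

Lemma card_ord_lt (C a : nat) : (a <= C)%N -> #|[pred j : 'I_C | (j < a)%N]| = a.
Proof.
move=> aC; rewrite -sum1_card -(big_ord_widen _ (fun=> 1%N)) //.
by rewrite sum1_card card_ord.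
Qed.

Lemma down_closed_ord (C : nat) (P : pred 'I_C) :
  (forall i j : 'I_C, (i <= j)%N -> P j -> P i) -> forall j, P j = (j < #|P|)%N.
Proof.
move=> Pd j; apply/idP/idP => [Pj|].
  have /esym/eq_leq/leq_trans -> // : #|[pred k : 'I_C | (k < j.+1)%N]| = j.+1.
    exact: card_ord_lt.
  by apply/subset_leq_card/fintype.subsetP => i; rewrite inE ltnS => /Pd; apply.
apply: contraTT => nPj; rewrite -leqNgt.
have /eq_leq : #|[pred k : 'I_C | (k < j)%N]| = j by apply/card_ord_lt/ltnW.
apply: leq_trans; apply/subset_leq_card/fintype.subsetP => i Pi.
by rewrite inE ltnNge; apply: contra nPj => /Pd; apply.
Qed.

Lemma antitone_leq (l : nat -> nat) :
  (forall i, (l i.+1 <= l i)%N) -> forall i j, (i <= j)%N -> (l j <= l i)%N.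
Proof.
move=> ld i j /subnKC <-; elim: (j - i)%N => [|d IH]; rewrite ?addn0 // addnS.
exact: leq_trans (ld _) IH.
Qed.

(** Entries increase strictly down a column, starting from at least 0. *)
Lemma matrix_tableau_row_le (L C B n : nat) (l : nat -> nat)
    (T : {ffun 'I_L * 'I_C -> 'I_B.+1}) :
  (forall i, (l i.+1 <= l i)%N) -> matrix_tableau n l T ->
  forall (i : 'I_L) (j : 'I_C), (j < l i)%N -> (i <= T (i, j))%N.
Proof.
move=> ld /asboolP[_ _ _ cs] i j jl.
suff H d (dL : (d < L)%N) : (d <= i)%N -> (d <= T (Ordinal dL, j))%N.
  have := H i (ltn_ord i) (leqnn _).
  by rewrite (_ : Ordinal _ = i) //; apply/val_inj.
elim: d dL => // d IH dL di.
apply: leq_ltn_trans (IH (ltnW dL) (ltnW di)) _; apply: cs => //=.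
exact: leq_trans jl (antitone_leq ld di).
Qed.

(** Deleting the cells that hold the largest entry [n] leaves a tableau whose shape interlaces [l],
    and every interlacing shape arises. The ambient rectangle and the completion value stay fixed,
    so that both tableaux live in one type. *)
Lemma matrix_tableau_branching (R : pzSemiRingType) (L C B n : nat) (l : nat -> nat) :
  (n <= L)%N -> (n <= B)%N -> (forall i, (l i.+1 <= l i)%N) ->
  (forall i, (n < i)%N -> l i = 0%N) -> (l 0%N <= C)%N ->
  \sum_(T : {ffun 'I_L.+1 * 'I_C -> 'I_B.+1} | matrix_tableau n.+1 l T) (1 : R)
  = \sum_(m : {ffun 'I_n -> 'I_C.+1} |
        [forall i : 'I_n, (l i.+1 <= m i)%N && (m i <= l i)%N])
    \sum_(T : {ffun 'I_L.+1 * 'I_C -> 'I_B.+1} | matrix_tableau n (ffun_ext m) T) 1.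
Proof.
move=> nL nB ld l0 lC.
have lleC i : (l i <= C)%N by apply: leq_trans (antitone_leq ld (leq0n i)) lC.
(* The remaining shape: row [i] keeps as many cells as it has entries below [n]. *)
pose mu (T : {ffun 'I_L.+1 * 'I_C -> 'I_B.+1}) : {ffun 'I_n -> 'I_C.+1} :=
  [ffun i : 'I_n => inord #|[pred j | (T (inord i, j) < n)%N]|].
have mu_val T (i : 'I_n) : mu T i = #|[pred j | (T (inord i, j) < n)%N]| :> nat.
  rewrite ffunE inordK // ltnS.
  by apply: leq_trans (max_card _) _; rewrite card_ord.
have iE (i : 'I_n) : inord (n' := L) i = i :> nat.
  by rewrite inordK // ltnS (leq_trans (ltnW (ltn_ord i))).
have muP T : matrix_tableau n.+1 l T -> forall (i : 'I_n) (j : 'I_C),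
    (T (inord i, j) < n)%N = (j < mu T i)%N.
  move=> /asboolP[_ _ rw _] i j; rewrite mu_val.
  rewrite -(down_closed_ord (P := [pred j | (T (inord i, j) < n)%N])) // => a b ab /=.
  exact/leq_ltn_trans/rw.
rewrite (partition_big mu (fun m : {ffun 'I_n -> 'I_C.+1} =>
    [forall i : 'I_n, (l i.+1 <= m i)%N && (m i <= l i)%N])) /=; last first.
  move=> T HT; have mP := muP T HT; case/asboolP: HT => sh ou rw cs.
  apply/forallP => i; apply/andP; split.
    (* Otherwise column [mu T i] would have an entry at least [n] in row [i] and a strictly larger
       one inside the shape below it, exceeding [n]. *)
    rewrite leqNgt; apply/negP => mlt.
    have mC : (mu T i < C)%N by apply: leq_trans mlt (lleC _).
    have := mP i (Ordinal mC); rewrite /= ltnn => /negbT; rewrite -leqNgt.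
    have iL : (i.+1 < L.+1)%N by rewrite ltnS (leq_trans (ltn_ord i)).
    have := cs (inord i) (Ordinal iL) (Ordinal mC).
    rewrite /= iE => /(_ (leqnn _) mlt) H1.
    have := sh (Ordinal iL) (Ordinal mC) mlt; rewrite ltnS => H2 H3.
    by have := leq_ltn_trans H3 (leq_trans H1 H2); rewrite ltnn.
  (* Otherwise the cell at column [l i], outside the shape, would have an entry below [n], while it
     holds [ord_max]. *)
  rewrite leqNgt; apply/negP => lt.
  have lCi : (l i < C)%N by rewrite (leq_trans lt) // -ltnS.
  have := mP i (Ordinal lCi); rewrite /= lt ou /= ?iE //.
  by rewrite ltnNge nB.
apply: eq_bigr => m /forallP mint.
have mlo (i : 'I_n) : (l i.+1 <= m i)%N by case/andP: (mint i).
have mhi (i : 'I_n) : (m i <= l i)%N by case/andP: (mint i).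
(* [up] writes [n] into the cells of [l] that [m] lacks; [down] erases these entries again. *)
pose up (T : {ffun 'I_L.+1 * 'I_C -> 'I_B.+1}) : {ffun 'I_L.+1 * 'I_C -> 'I_B.+1} :=
  [ffun p => if (T p < n)%N then T p else if (p.2 < l p.1)%N then inord n else ord_max].
pose down (T : {ffun 'I_L.+1 * 'I_C -> 'I_B.+1}) : {ffun 'I_L.+1 * 'I_C -> 'I_B.+1} :=
  [ffun p => if (T p < n)%N then T p else ord_max].
have nE : inord (n' := B) n = n :> nat by rewrite inordK.
have nmax : (@ord_max B < n)%N = false by rewrite /= ltnNge nB.
rewrite (reindex_onto up down) /=; last first.
  move=> T /andP[/asboolP[sh ou _ _] _]; apply/ffunP => -[i j]; rewrite !ffunE /=.
  case: (ltnP (T (i, j)) n) => [-> //|nT]; rewrite nmax.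
  case: ltnP => [jl|/ou -> //]; apply/val_inj => /=; rewrite nE.
  by apply/eqP; rewrite eqn_leq nT -ltnS sh.
apply: eq_bigl => T'; apply/idP/idP.
  case/andP => /andP[HT /eqP muT] /eqP <-; move: (up T') muT HT => T muT HT.
  have mP := muP T HT; rewrite muT in mP.
  (* Rows of index at least [n] have no entry below [n], which agrees with the zero extension of
     [m]. *)
  have Tge (i : 'I_L.+1) (j : 'I_C) : (n <= i)%N -> (n <= T (i, j))%N.
    move=> ni; case: (ltnP j (l i)) => [jl|]; last first.
      by case/asboolP: HT => _ ou _ _ /ou ->.
    exact: leq_trans ni (matrix_tableau_row_le ld HT jl).
  have mP' (i : 'I_L.+1) (j : 'I_C) : (T (i, j) < n)%N = (j < ffun_ext m i)%N.
    case: (ltnP i n) => [iltn|nlei].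
      rewrite -[i : nat]/(Ordinal iltn : nat) ffun_extE -mP.
      by rewrite (_ : inord _ = i) //; apply/val_inj; rewrite /= inordK.
    rewrite /ffun_ext insubN -?leqNgt // ltn0; apply/negbTE.
    by rewrite -leqNgt Tge.
  have extl (i : 'I_L.+1) : (ffun_ext m i <= l i)%N.
    case: (ltnP i n) => [iltn|nlei].
      by rewrite -[i : nat]/(Ordinal iltn : nat) ffun_extE.
    by rewrite /ffun_ext insubN // -leqNgt.
  case/asboolP: HT => sh ou rw cs; apply/asboolP; split => [i j|i j|i j j' jj'|i i' j ii' jm].
  - by rewrite ffunE -mP' => H; rewrite H.
  - by rewrite ffunE leqNgt -mP' => /negbTE ->.
  - rewrite !ffunE; case: (ltnP (T (i, j)) n) => H.
      by case: ifP => _; [exact: rw|rewrite -ltnS].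
    by rewrite ltnNge (leq_trans H (rw _ _ _ jj')).
  have H' : (T (i', j) < n)%N by rewrite mP'.
  have lt : (T (i, j) < T (i', j))%N by apply: cs => //; apply: leq_trans jm (extl _).
  by rewrite !ffunE H' (ltn_trans lt H').
move=> /asboolP[sh ou rw cs].
have extE (i : 'I_L.+1) (iltn : (i < n)%N) : ffun_ext m i = m (Ordinal iltn).
  by rewrite -[i : nat]/(Ordinal iltn : nat) ffun_extE.
have extl (i : 'I_L.+1) : (ffun_ext m i <= l i)%N.
  case: (ltnP i n) => [iltn|nlei]; first by rewrite extE.
  by rewrite /ffun_ext insubN // -leqNgt.
have upltn p : (up T' p < n)%N = (T' p < n)%N.
  rewrite ffunE; case: ifP => [->//|_]; case: ifP => _; last by rewrite nmax.
  by rewrite nE ltnn.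
have ltE (i : 'I_L.+1) (j : 'I_C) : (T' (i, j) < n)%N = (j < ffun_ext m i)%N.
  case: (ltnP j) => [/sh //|/ou ->]; exact: nmax.
apply/andP; split; last first.
  apply/eqP/ffunP => p; rewrite ffunE upltn ffunE.
  case: (ltnP (T' p) n) => //; case: p => i j H.
  by rewrite ou // leqNgt -ltE ltnNge H.
apply/andP; split; last first.
  apply/eqP/ffunP => i; apply/val_inj => /=; rewrite mu_val.
  transitivity #|[pred j : 'I_C | (j < m i)%N]|; last first.
    by rewrite card_ord_lt // (leq_trans (mhi _) (lleC _)).
  apply: eq_card => j; rewrite !inE upltn ltE iE.
  by rewrite ffun_extE.
apply/asboolP; split => [i j jl|i j lj|i j j' jj'|i i' j ii' jl].
- rewrite ffunE; case: ifP => [/ltnW //|_].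
  by rewrite jl nE.
- rewrite ffunE ltE ltnNge (leq_trans (extl i) lj) /=.
  by rewrite ltnNge lj.
- rewrite !ffunE /=; case: (ltnP (T' (i, j)) n) => H.
    case: ifP => [_|_]; first exact: rw.
    by case: ifP => _; [rewrite nE ltnW|rewrite -ltnS].
  have /negbTE -> : ~~ (T' (i, j') < n)%N by rewrite -leqNgt (leq_trans H (rw _ _ _ jj')).
  case: (ltnP j (l i)) => jl; first by case: ifP => _; rewrite // nE.
  by rewrite ltnNge (leq_trans jl jj').
have iltn : (i < n)%N.
  by rewrite ltnNge; apply/negP => ni; move: jl; rewrite l0 ?ltn0 // (leq_ltn_trans ni).
(* By interlacing, a cell of [l] with another cell of [l] below it already belongs to [m]; hence [n]
   never occurs twice in a column. *)
have H : (T' (i, j) < n)%N.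
  rewrite ltE extE (leq_trans jl) //; apply: leq_trans (mlo _) => /=.
  exact: antitone_leq.
rewrite !ffunE H /=; case: (ltnP (T' (i', j)) n) => H'.
  by apply: cs => //; rewrite -ltE.
by rewrite jl nE.
Qed.

(** The number of tableaux and the determinant satisfy the same recursion over interlacing shapes.
    For [n = 0] the only tableau is constantly [ord_max]. *)
Lemma sum_matrix_tableau (R : comNzRingType) (L C B n : nat) (l : nat -> nat) :
  (n <= L.+1)%N -> (n <= B.+1)%N -> (forall i, (l i.+1 <= l i)%N) ->
  (forall i, (n <= i)%N -> l i = 0%N) -> (l 0%N <= C)%N ->
  \sum_(T : {ffun 'I_L.+1 * 'I_C -> 'I_B.+1} | matrix_tableau n l T) (1 : R)
  = \det (bin_matrix R n l).
Proof.
elim: n l => [|n IH] l nL nB ld l0 lC.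
  rewrite det_mx00 (big_pred1 [ffun=> ord_max]) // => T; apply/asboolP/eqP.
    by case=> _ ou _ _; apply/ffunP => -[i j]; rewrite ffunE ou // l0.
  move=> ->; split=> [i j|i j _|i j j' _|i i' j _]; rewrite ?l0 ?ltn0 //.
    by rewrite ffunE.
  by rewrite !ffunE.
rewrite matrix_tableau_branching // (det_bin_matrixS R (K := C)) //.
apply: eq_bigr => m /forallP mint.
have mlo (i : 'I_n) : (l i.+1 <= m i)%N by case/andP: (mint i).
have mhi (i : 'I_n) : (m i <= l i)%N by case/andP: (mint i).
have extE i (iltn : (i < n)%N) : ffun_ext m i = m (Ordinal iltn).
  by rewrite -[i : nat]/(Ordinal iltn : nat) ffun_extE.
have ext0 i : (n <= i)%N -> ffun_ext m i = 0%N.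
  by move=> ni; rewrite /ffun_ext insubN // -leqNgt.
apply: IH => //; [exact: ltnW|exact: ltnW| |].
  move=> i; case: (ltnP i.+1 n) => [H|/ext0 -> //].
  rewrite (extE _ H) (extE _ (ltnW H)).
  exact: leq_trans (mhi (Ordinal H)) (mlo (Ordinal (ltnW H))).
case: (ltnP 0 n) => [H|/ext0 -> //]; rewrite (extE _ H).
exact: leq_trans (mhi (Ordinal H)) lC.
Qed.

(** * Partitions, cells and semistandard tableaux *)

Lemma is_partition_antitone (la : seq nat) :
  is_partition la -> forall i, (nth 0%N la i.+1 <= nth 0%N la i)%N.
Proof.
case/andP => so _ i; case: (ltnP i.+1 (size la)) => [ilt|/(nth_default 0%N) -> //].
have tr : transitive geq by move=> a b c /= ab bc; apply: leq_trans bc ab.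
by apply: (sorted_ltn_nth tr 0%N so) => //; rewrite inE // ltnW.
Qed.

Lemma is_partition_gt0 (la : seq nat) :
  is_partition la -> forall i, (i < size la)%N -> (0 < nth 0%N la i)%N.
Proof.
case/andP => _ n0 i ilt; rewrite lt0n; apply: contra n0 => /eqP <-.
exact: mem_nth.
Qed.

(** A partial inverse of [cell_row] and [cell_col] on plain numbers, which keeps the dependent type
    of cells out of later arguments. *)
Definition cell_at (la : seq nat) (i j : nat) : option (cell la) :=
  if (insub i : option 'I_(size la)) is Some i' then
    omap (fun j' : 'I_(nth 0%N la i') =>
      Tagged (fun i : 'I_(size la) => 'I_(nth 0%N la i)) j') (insub j)
  else None.

Lemma cell_atK (la : seq nat) (c : cell la) : cell_at la (cell_row c) (cell_col c) = Some c.
Proof.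
by case: c => i j; rewrite /cell_at /cell_row /cell_col /= !valK.
Qed.

Lemma cell_atP (la : seq nat) (i j : nat) (c : cell la) :
  cell_at la i j = Some c -> cell_row c = i /\ cell_col c = j.
Proof.
rewrite /cell_at; case: insubP => //= i' _ <-; case: insubP => //= j' _ <- [<-].
by [].
Qed.

Lemma cell_at_ex (la : seq nat) (i j : nat) :
  (j < nth 0%N la i)%N -> exists c, cell_at la i j = Some c.
Proof.
move=> jl; have il : (i < size la)%N.
  by rewrite ltnNge; apply/negP => /(nth_default 0%N) E; rewrite E in jl.
pose c : cell la := Tagged (fun i : 'I_(size la) => 'I_(nth 0%N la i))
  (Ordinal (jl : (j < nth 0%N la (Ordinal il))%N)).
by exists c; exact: (cell_atK c).
Qed.

Lemma cell_col_lt (la : seq nat) (c : cell la) : (cell_col c < nth 0%N la (cell_row c))%N.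
Proof. by case: c => i j; exact: (ltn_ord j). Qed.

Lemma semistandardP (la : seq nat) (N : nat) (T : {ffun cell la -> 'I_N}) :
  reflect ((forall c d, cell_row c = cell_row d -> (cell_col c <= cell_col d)%N ->
              (T c <= T d)%N)
        /\ (forall c d, cell_col c = cell_col d -> (cell_row c < cell_row d)%N ->
              (T c < T d)%N)) (semistandard T).
Proof.
apply: (iffP forallP) => [H|[H1 H2] c].
  split=> c d /eqP e1 e2; have /forallP/(_ d)/andP[/implyP h1 /implyP h2] := H c.
    by apply: h1; rewrite e1.
  by apply: h2; rewrite e1.
apply/forallP => d; apply/andP; split; apply/implyP => /andP[/eqP e1 e2].
  exact: H1.
exact: H2.
Qed.

(** At all variables equal to 1 the Schur polynomial counts tableaux. [ext] fills the outside of the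
    shape with [ord_max], which is [L.+1] and thus no legal entry; [res] restricts back to the
    cells. *)
Lemma schur_matrix_tableau (R : comNzRingType) (la : seq nat) (L K : nat) :
  is_partition la -> (size la <= L.+1)%N -> (nth 0%N la 0 <= K.+1)%N ->
  schur la (fun _ : 'I_L.+1 => 1 : R)
  = \sum_(T : {ffun 'I_L.+1 * 'I_K.+1 -> 'I_L.+2} | matrix_tableau L.+1 (nth 0%N la) T) 1.
Proof.
move=> pla sL hK; rewrite /schur.
under eq_bigr do rewrite big1 //.
have rL (c : cell la) : (cell_row c < L.+1)%N by apply: leq_trans (ltn_ord _) sL.
have cK (c : cell la) : (cell_col c < K.+1)%N.
  apply: leq_trans (cell_col_lt c) (leq_trans _ hK).
  by apply: antitone_leq => // i; apply: is_partition_antitone.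
pose ext (T : {ffun cell la -> 'I_L.+1}) : {ffun 'I_L.+1 * 'I_K.+1 -> 'I_L.+2} :=
  [ffun p : 'I_L.+1 * 'I_K.+1 => if cell_at la p.1 p.2 is Some c then inord (T c) else ord_max].
pose res (U : {ffun 'I_L.+1 * 'I_K.+1 -> 'I_L.+2}) : {ffun cell la -> 'I_L.+1} :=
  [ffun c => inord (U (Ordinal (rL c), Ordinal (cK c)))].
have extE T c (i : 'I_L.+1) (j : 'I_K.+1) : cell_at la i j = Some c ->
    ext T (i, j) = T c :> nat.
  by move=> e; rewrite ffunE /= e inordK // ltnW // ltnS ltn_ord.
have extN T (i : 'I_L.+1) (j : 'I_K.+1) : (nth 0%N la i <= j)%N ->
    ext T (i, j) = ord_max.
  move=> e; rewrite ffunE /=; case E: (cell_at la i j) => [c|//].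
  by case/cell_atP: E => r c'; have := cell_col_lt c; rewrite r c' ltnNge e.
rewrite [RHS](reindex_onto ext res) /=; last first.
  move=> U /asboolP[sh ou _ _]; apply/ffunP => -[i j]; apply/val_inj.
  case: (ltnP j (nth 0%N la i)) => [jl|lj]; last by rewrite extN // ou.
  have [c e] := cell_at_ex jl; have [r c'] := cell_atP e.
  rewrite /= (extE _ _ _ _ e) ffunE.
  have -> : Ordinal (rL c) = i by apply/val_inj.
  have -> : Ordinal (cK c) = j by apply/val_inj.
  by rewrite inordK // sh.
apply: eq_bigl => T; apply/semistandardP/andP.
  case=> H1 H2; split; last first.
    apply/eqP/ffunP => c; rewrite ffunE; apply/val_inj.
    by rewrite /= (extE _ c) ?cell_atK // inord_val.
  apply/asboolP; split=> [i j jl|i j lj|i j j' jj'|i i' j ii' jl].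
  - by have [c e] := cell_at_ex jl; rewrite (extE _ _ _ _ e).
  - exact: extN.
  - case: (ltnP j' (nth 0%N la i)) => [jl|lj]; last first.
      by rewrite [ext T (i, j')]extN // -ltnS.
    have [c e] := cell_at_ex (leq_ltn_trans jj' jl); have [c1 e1] := cell_at_ex jl.
    rewrite (extE _ _ _ _ e) (extE _ _ _ _ e1).
    have [r k] := cell_atP e; have [r1 k1] := cell_atP e1.
    by apply: H1; rewrite ?k ?k1 ?r ?r1.
  have jl' : (j < nth 0%N la i)%N.
    by apply: leq_trans jl _; apply: antitone_leq (ltnW ii') => k; apply: is_partition_antitone.
  have [c e] := cell_at_ex jl'; have [c1 e1] := cell_at_ex jl.
  rewrite (extE _ _ _ _ e) (extE _ _ _ _ e1).
  have [r k] := cell_atP e; have [r1 k1] := cell_atP e1.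
  by apply: H2; rewrite ?k ?k1 ?r ?r1.
case=> /asboolP[_ _ rw cs] _.
have TE c : T c = ext T (Ordinal (rL c), Ordinal (cK c)) :> nat.
  by rewrite (extE _ c) ?cell_atK.
split=> c d e1 e2; rewrite !TE.
  have -> : Ordinal (rL d) = Ordinal (rL c) by apply/val_inj.
  exact: rw.
have -> : Ordinal (cK d) = Ordinal (cK c) by apply/val_inj.
by apply: cs => //=; rewrite e1; apply: cell_col_lt.
Qed.

Theorem schur_det (R : comNzRingType) (la : seq nat) (L : nat) :
  is_partition la -> (size la <= L.+1)%N ->
  schur la (fun _ : 'I_L.+1 => 1 : R) = \det (bin_matrix R L.+1 (nth 0%N la)).
Proof.
move=> pla sL; rewrite (schur_matrix_tableau R (K := nth 0%N la 0)) ?leqnSn //.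
apply: sum_matrix_tableau => //; first by move=> i; apply: is_partition_antitone.
by move=> i Li; rewrite nth_default // (leq_trans sL).
Qed.

(** The first column would need [size la] distinct entries among only [N] values. *)
Lemma schur_oversize (R : comNzRingType) (la : seq nat) (N : nat) (x : 'I_N -> R) :
  is_partition la -> (N < size la)%N -> schur la x = 0.
Proof.
move=> pla Nl; rewrite /schur big_pred0 // => T; apply/negbTE/negP.
case/semistandardP => _ cs.
pose c (i : 'I_(size la)) : cell la :=
  Tagged (fun i : 'I_(size la) => 'I_(nth 0%N la i))
    (Ordinal (is_partition_gt0 pla (ltn_ord i))).
have Tc_inj : injective (fun i => T (c i)).
  move=> i j e; apply/val_inj => /=.
  case: (ltngtP i j) => // ij.
    by have := cs (c i) (c j) erefl ij; rewrite e ltnn.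
  by have := cs (c j) (c i) erefl ij; rewrite e ltnn.
by have := leq_card _ Tc_inj; rewrite !card_ord leqNgt Nl.
Qed.

(** * Meixner polynomials and their moments *)

(* Coefficient of [z ^ n] in [(1 - z) ^ h / (1 - q z) ^ h.+1]: the Meixner
   polynomial [q ^ n M_n(h; 1, q)]. *)
Definition meixner (R : nzRingType) (q : R) (n h : nat) : R :=
  \sum_(j < n.+1) ('C(n, j) * 'C(h, j))%:R * (q ^+ (n - j) * (q - 1) ^+ j).

(** Multiplication by the variable on generating functions. *)
Definition delay (V : nmodType) (f : nat -> V) (n : nat) : V :=
  if n is n'.+1 then f n' else 0.

Section Meixner.
Variables (R : comNzRingType) (q : R).

Lemma meixner_at0 n : meixner q n 0 = q ^+ n.
Proof.
rewrite /meixner big_ord_recl /= bin0 bin0 subn0 expr0 mulr1 mul1r big1 ?addr0 //.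
by move=> i _; rewrite muln0 mul0r.
Qed.

Lemma meixner_deg0 h : meixner q 0 h = 1.
Proof. by rewrite /meixner big_ord1 !bin0 !expr0 !mulr1. Qed.

(** With [G_h = (1 - z) ^ h / (1 - q z) ^ h.+1], this is the coefficient form of
    [(1 - q z) G_(h+1) = (1 - z) G_h]. *)
Lemma meixner_shift n h :
  meixner q n.+1 h.+1 - q * meixner q n h.+1 = meixner q n.+1 h - meixner q n h.
Proof.
(* Forward difference in [h], by Pascal's rule. *)
have dE k : meixner q k h.+1 - meixner q k h
    = \sum_(j < k) ('C(k, j.+1) * 'C(h, j))%:R * (q ^+ (k - j.+1) * (q - 1) ^+ j.+1).
  rewrite /meixner -sumrB big_ord_recl !bin0 subrr add0r; apply: eq_bigr => j _.
  by rewrite lift0 binS -mulrBl -natrB ?leq_mul ?leq_addr // mulnDr addKn.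
suff : meixner q n.+1 h.+1 - meixner q n.+1 h
    = q * (meixner q n h.+1 - meixner q n h) + (q - 1) * meixner q n h.
  move/(canRL (subrK _)) ->; ring.
rewrite !dE /meixner [X in q * X](_ : _ = \sum_(j < n.+1)
    ('C(n, j.+1) * 'C(h, j))%:R * (q ^+ (n - j.+1) * (q - 1) ^+ j.+1)); last first.
  by rewrite big_ord_recr /= bin_small // mul0n mul0r addr0.
rewrite !mulr_sumr -big_split /=; apply: eq_bigr => j _.
rewrite binS mulnDl natrD subSS exprS.
have [jn|nj] := ltnP j n; last first.
  have -> : 'C(n, j.+1) = 0%N by rewrite bin_small.
  rewrite mul0n; ring.
have -> : (n - j = (n - j.+1).+1)%N by rewrite -subSn.
rewrite exprS; ring.
Qed.

Lemma meixner_sub_delay n h :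
  meixner q n h.+1 - q * delay (fun n' => meixner q n' h.+1) n
  = meixner q n h - delay (fun n' => meixner q n' h) n.
Proof.
case: n => [|n] /=; first by rewrite !meixner_deg0 mulr0.
exact: meixner_shift.
Qed.

(** Coefficient form of [(1 - q z) G_0 = 1]. *)
Lemma meixner_sub_delay0 n :
  meixner q n 0 - q * delay (fun n' => meixner q n' 0) n = (n == 0%N)%:R.
Proof.
case: n => [|n] /=; first by rewrite meixner_at0 mulr0 subr0.
by rewrite !meixner_at0 exprS subrr.
Qed.

End Meixner.


(** Induction on [d]: by Pascal's rule, [1 - q] times a partial sum for [d + 1] is a partial sum for
    [d] minus a nonnegative remainder. This bounds the partial sums, so they converge. *)
Lemma cvg_series_bin_geometric (R : realType) (q : R) (d : nat) :
  0 <= q -> q < 1 ->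
  series (fun h => 'C(h + d, d)%:R * q ^+ h) @ \oo --> (1 - q)^-1 ^+ d.+1.
Proof.
move=> q0 q1; have q1' : 1 - q != 0 by rewrite subr_eq0 eq_sym lt_eqF.
elim: d => [|d IH].
  rewrite expr1 -[X in _ --> X]mul1r.
  rewrite (_ : (fun h => _) = geometric 1 q); last first.
    by apply/funext => h; rewrite /geometric /= bin0.
  by apply: cvg_geometric_series; rewrite ger0_norm.
set u := fun h => _ in IH; set v := fun h => _.
have vS M : (1 - q) * series v M = series u M - 'C(M + d, d.+1)%:R * q ^+ M.
  elim: M => [|M IHM].
    by rewrite /series /= !big_geq // mulr0 add0n bin_small // mul0r subrr.
  rewrite !seriesSr mulrDr IHM /u /v addnS addSn binS natrD exprS; ring.
have v0 h : 0 <= v h by rewrite mulr_ge0 ?exprn_ge0.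
have u0 h : 0 <= u h by rewrite mulr_ge0 ?exprn_ge0.
have vcvg : cvgn (series v).
  apply: nondecreasing_is_cvgn; first exact: nondecreasing_series.
  exists ((1 - q)^-1 ^+ d.+2) => _ [M _ <-].
  rewrite exprS ler_pdivlMl ?subr_gt0 // vS.
  apply: (@le_trans _ _ (series u M)).
    by rewrite gerBl mulr_ge0 ?exprn_ge0.
  have := nondecreasing_cvgn_le (nondecreasing_series (fun n _ _ => u0 n)) (cvgP _ IH) M.
  by rewrite (cvg_lim _ IH).
(* After a shift by one, the remainder is [q] times the general term of a convergent series. *)
have rem0 : (fun M => 'C(M + d, d.+1)%:R * q ^+ M) @ \oo --> (0 : R).
  rewrite -cvg_shiftS /=.
  rewrite (_ : (fun M => _) = (fun M => q * v M)); last first.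
    by apply/funext => M; rewrite /v addSnnS exprS mulrCA.
  have := cvgMl_tmp (a := q) (cvg_series_cvg_0 vcvg).
  by rewrite mulr0 => H; exact: H.
rewrite (_ : series v = fun M => (1 - q)^-1 * (series u M - 'C(M + d, d.+1)%:R * q ^+ M)).
  rewrite exprS -[X in _ * X]subr0; apply: cvgMl_tmp.
  exact: cvgB.
by apply/funext => M; rewrite -vS mulKf.
Qed.

(** * Sequences of polynomial growth *)

Definition poly_bounded (R : realType) (f : nat -> R) : Prop :=
  exists C d, forall h, `|f h| <= C * h.+1%:R ^+ d.

Section PolyBounded.
Variable R : realType.
Implicit Types f g : nat -> R.

Lemma poly_bounded_ge0 f C d : (forall h, `|f h| <= C * h.+1%:R ^+ d) -> 0 <= C.
Proof. by move=> /(_ 0%N); rewrite expr1n mulr1; apply: le_trans. Qed.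

Lemma poly_bounded_cst (c : R) : poly_bounded (fun=> c).
Proof. by exists `|c|, 0%N => h; rewrite expr0 mulr1. Qed.

Lemma poly_boundedM f g :
  poly_bounded f -> poly_bounded g -> poly_bounded (fun h => f h * g h).
Proof.
move=> [C [d Hf]] [D [e Hg]]; exists (C * D), (d + e)%N => h.
by rewrite normrM exprD mulrACA ler_pM.
Qed.

Lemma poly_boundedD f g :
  poly_bounded f -> poly_bounded g -> poly_bounded (fun h => f h + g h).
Proof.
move=> [C [d Hf]] [D [e Hg]]; exists (C + D), (d + e)%N => h.
have C0 := poly_bounded_ge0 Hf; have D0 := poly_bounded_ge0 Hg.
apply: le_trans (ler_normD _ _) _; rewrite mulrDl lerD //.
  (* The base [h.+1] is at least 1, so both exponents can be raised to [d + e]. *)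
  apply: le_trans (Hf h) _; rewrite ler_wpM2l // ler_weXn2l ?leq_addr //.
  by rewrite (ler_nat _ 1).
apply: le_trans (Hg h) _; rewrite ler_wpM2l // ler_weXn2l ?leq_addl //.
by rewrite (ler_nat _ 1).
Qed.

Lemma poly_bounded_sum (I : Type) (r : seq I) (F : I -> nat -> R) :
  (forall i, poly_bounded (F i)) -> poly_bounded (fun h => \sum_(i <- r) F i h).
Proof.
move=> HF; elim: r => [|i r IH].
  by under eq_fun do rewrite big_nil; exact: poly_bounded_cst.
by under eq_fun do rewrite big_cons; exact: poly_boundedD.
Qed.

Lemma poly_bounded_bin (j : nat) : poly_bounded (fun h => 'C(h, j)%:R : R).
Proof.
exists 1, j => h; rewrite normr_nat mul1r -natrX ler_nat.
apply: (@leq_trans (h ^_ j)); first by rewrite -bin_ffact leq_pmulr ?fact_gt0.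
elim: j => [|j IH]; first by rewrite ffactn0.
by rewrite ffactnSr expnSr leq_mul // (leq_trans (leq_subr _ _)).
Qed.

Lemma poly_bounded_meixner (q : R) (n : nat) : poly_bounded (meixner q n).
Proof.
apply: poly_bounded_sum => j; apply: poly_boundedM; last exact: poly_bounded_cst.
under eq_fun do rewrite natrM.
by apply: poly_boundedM; [exact: poly_bounded_cst|exact: poly_bounded_bin].
Qed.

Lemma poly_bounded_shift f : poly_bounded f -> poly_bounded (fun h => f h.+1).
Proof.
move=> [C [d Hf]]; exists (C * 2 ^+ d), d => h.
apply: le_trans (Hf _) _; rewrite -mulrA ler_wpM2l ?(poly_bounded_ge0 Hf) //.
by rewrite -exprMn lerXn2r ?nnegrE ?mulr_ge0 // -natrM ler_nat; lia.
Qed.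

End PolyBounded.

(** * Moments against the geometric weight *)

Definition weighted_sum (R : realType) (q : R) (k : nat) (f : nat -> R) : R :=
  limn (series (fun h => 'C(h, k)%:R * f h * q ^+ h)).

Section WeightedSum.
Variables (R : realType) (q : R).
Hypotheses (q0 : 0 < q) (q1 : q < 1).
Implicit Types f g : nat -> R.

(** Comparison with the negative binomial series, through [(h + 1) ^ d <= d! C(h + d, d)]. *)
Lemma weighted_sum_cvg k f : poly_bounded f ->
  series (fun h => 'C(h, k)%:R * f h * q ^+ h) @ \oo --> weighted_sum q k f.
Proof.
move=> pf; suff H : cvgn (series (fun h => 'C(h, k)%:R * f h * q ^+ h)) by [].
have [C [d Hd]] := poly_boundedM (poly_bounded_bin R k) pf.
have C0 := poly_bounded_ge0 Hd.
apply: normed_cvg.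
have expd h : h.+1%:R ^+ d <= d`!%:R * 'C(h + d, d)%:R :> R.
  rewrite -natrM -natrX ler_nat mulnC bin_ffact.
  elim: d {Hd} => [|e IH]; first by rewrite ffactn0.
  by rewrite addnS ffactnS expnS /= leq_mul // ltnS leq_addr.
apply: (@series_le_cvg _ _ (fun h => (C * d`!%:R) * ('C(h + d, d)%:R * q ^+ h))) => [h|h|h|].
- exact: normr_ge0.
- by rewrite !mulr_ge0 // exprn_ge0 // ltW.
- have qh0 : 0 <= q ^+ h by rewrite exprn_ge0 // ltW.
  rewrite /= normrM (ger0_norm qh0) [leRHS]mulrA ler_wpM2r //.
  apply: le_trans (Hd h) _.
  by rewrite -mulrA ler_wpM2l.
have := @cvg_series_bin_geometric R q d (ltW q0) q1.
by move=> /cvgP/(is_cvg_seriesZ (k := C * d`!%:R)).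
Qed.

Lemma weighted_sumZD k a f g : poly_bounded f -> poly_bounded g ->
  weighted_sum q k (fun h => f h + a * g h) = weighted_sum q k f + a * weighted_sum q k g.
Proof.
move=> pf pg; apply: cvg_lim => //.
rewrite (_ : series _ = series (fun h => 'C(h, k)%:R * f h * q ^+ h)
    + (fun M => a * series (fun h => 'C(h, k)%:R * g h * q ^+ h) M)).
  by apply: cvgD; [|apply: cvgMl_tmp]; exact: weighted_sum_cvg.
apply/funext => M; rewrite fctE /series /= mulr_sumr -[RHS]big_split /=.
apply: eq_bigr => h _; rewrite mulrDr mulrDl; congr (_ + _).
by rewrite !mulrA [_ * a]mulrC.
Qed.

(** The term at [h = 0] is split off, and Pascal's rule for [C(h + 1, k)] yields the orders [k] and
    [k - 1]. This is where binomials serve better than falling factorials. *)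
Lemma weighted_sum_shift k f : poly_bounded f ->
  weighted_sum q k f = (k == 0%N)%:R * f 0%N
    + q * (weighted_sum q k (fun h => f h.+1)
           + delay (fun k' => weighted_sum q k' (fun h => f h.+1)) k).
Proof.
move=> pf; have ps := poly_bounded_shift pf.
have H : series (fun h => 'C(h.+1, k)%:R * f h.+1 * q ^+ h) @ \oo -->
    weighted_sum q k (fun h => f h.+1) + delay (fun k' => weighted_sum q k' (fun h => f h.+1)) k.
  case: k => [|k] /=.
    rewrite addr0 (_ : (fun h => _) = (fun h => 'C(h, 0)%:R * f h.+1 * q ^+ h)).
      exact: weighted_sum_cvg.
    by apply/funext => h; rewrite !bin0.
  rewrite (_ : series _ = series (fun h => 'C(h, k.+1)%:R * f h.+1 * q ^+ h)
     + series (fun h => 'C(h, k)%:R * f h.+1 * q ^+ h)).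
    by apply: cvgD; exact: weighted_sum_cvg.
  apply/funext => M; rewrite fctE /series /= -[RHS]big_split /=; apply: eq_bigr => h _.
  by rewrite binS natrD !mulrDl.
apply: cvg_lim => //; rewrite -cvg_shiftS /=.
rewrite (_ : (fun M => _) = fun M => (k == 0%N)%:R * f 0%N
    + q * series (fun h => 'C(h.+1, k)%:R * f h.+1 * q ^+ h) M).
  by apply: cvgD; [exact: cvg_cst|exact: cvgMl_tmp].
apply/funext => M; rewrite /series /= big_nat_recl // expr0 mulr1 bin0n; congr (_ + _).
rewrite mulr_sumr; apply: eq_bigr => h _.
by rewrite exprS mulrCA.
Qed.

Definition meixner_gram k n m : R :=
  weighted_sum q k (fun h => meixner q n h * meixner q m h).

Local Notation A := meixner_gram.

Lemma poly_bounded_delay (F : nat -> nat -> R) n :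
  (forall n, poly_bounded (F n)) -> poly_bounded (fun h => delay (F^~ h) n).
Proof. by case: n => [|n] ? //=; exact: poly_bounded_cst. Qed.

Lemma weighted_sum0 k : weighted_sum q k (fun=> 0) = 0.
Proof.
apply: cvg_lim => //; rewrite (_ : series _ = fun=> 0); first exact: cvg_cst.
by apply/funext => M; rewrite /series /= big1 // => i _; rewrite mulr0 mul0r.
Qed.

(** On generating functions in [z] and [w]: multiplication by [(1 - c z) (1 - c w)]. It is applied
    with [c = q] and with [c = 1]. *)
Lemma meixner_gram_expand k n m c :
  weighted_sum q k (fun h => (meixner q n h - c * delay (fun n' => meixner q n' h) n)
                           * (meixner q m h - c * delay (fun m' => meixner q m' h) m))
  = A k n m - c * delay (A k n) m - c * delay (fun n' => A k n' m) n
    + c ^+ 2 * delay (fun n' => delay (A k n') m) n.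
Proof.
pose P := meixner q; pose Q n h := delay (fun n' => meixner q n' h) n.
have pP i : poly_bounded (P i) by exact: poly_bounded_meixner.
have pQ i : poly_bounded (Q i) by exact: poly_bounded_delay.
transitivity (weighted_sum q k (fun h => P n h * P m h + - c * (P n h * Q m h)
   + - c * (Q n h * P m h) + c ^+ 2 * (Q n h * Q m h))).
  congr weighted_sum; apply/funext => h; rewrite -/P /P /Q; ring.
rewrite !weighted_sumZD; do ?[exact: poly_boundedM |
  apply: poly_boundedD | apply: (poly_boundedM (poly_bounded_cst _))].
have E1 : weighted_sum q k (fun h => P n h * Q m h) = delay (A k n) m.
  rewrite /Q; case: m => [|m] //=; rewrite -[RHS](weighted_sum0 k).
  by congr weighted_sum; apply/funext => h; rewrite mulr0.
have E2 : weighted_sum q k (fun h => Q n h * P m h) = delay (fun n' => A k n' m) n.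
  clear E1; rewrite /Q; case: n => [|n] //=; rewrite -[RHS](weighted_sum0 k).
  by congr weighted_sum; apply/funext => h; rewrite mul0r.
have E3 : weighted_sum q k (fun h => Q n h * Q m h) = delay (fun n' => delay (A k n') m) n.
  clear E1 E2; rewrite /Q; case: n m => [|n] [|m] //=; rewrite -[RHS](weighted_sum0 k);
  by congr weighted_sum; apply/funext => h; rewrite ?mul0r ?mulr0.
by rewrite E1 E2 E3 -/(A k n m) !mulNr.
Qed.

(** Let [Phi_k] be the generating function of [A k], with [Phi_(-1) = 0]. The shift gives [(1 - q z)
    (1 - q w) Phi_k = [k = 0] + q (1 - z) (1 - w) (Phi_k + Phi_(k-1))], and [(1 - q z) (1 - q w) - q
    (1 - z) (1 - w) = (1 - q) (1 - q z w)]. *)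
Lemma meixner_gram_rec k n m :
  (1 - q) * (A k n m - q * delay (fun n' => delay (A k n') m) n)
  = ((k == 0%N) && (n == 0%N) && (m == 0%N))%:R
    + q * delay (fun k' => A k' n m - delay (A k' n) m - delay (fun n' => A k' n' m) n
                          + delay (fun n' => delay (A k' n') m) n) k.
Proof.
pose D c n h := meixner q n h - c * delay (fun n' => meixner q n' h) n.
have pD c i : poly_bounded (D c i).
  apply: poly_boundedD; first exact: poly_bounded_meixner.
  under eq_fun do rewrite -mulNr.
  apply: poly_boundedM; first exact: poly_bounded_cst.
  by apply: poly_bounded_delay => ?; exact: poly_bounded_meixner.
have := weighted_sum_shift k (poly_boundedM (pD q n) (pD q m)).
rewrite [X in (_ == _)%:R * X](_ : _ = ((n == 0%N) && (m == 0%N))%:R); last first.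
  by rewrite /D !meixner_sub_delay0 -natrM mulnb.
(* At [h + 1] the factors with [c = q] become those with [c = 1] at [h]. *)
have shE : (fun h => D q n h.+1 * D q m h.+1) = (fun h => D 1 n h * D 1 m h).
  by apply/funext => h; rewrite /D !meixner_sub_delay !mul1r.
rewrite !shE /D !meixner_gram_expand -natrM mulnb andbA.
have E k' := meixner_gram_expand k' n m 1.
rewrite (_ : delay _ k = delay (fun k' =>
    A k' n m - delay (A k' n) m - delay (fun n' => A k' n' m) n
                          + delay (fun n' => delay (A k' n') m) n) k); last first.
  by case: (k) => //= k'; rewrite E expr1n !mul1r.
rewrite expr1n !mul1r.
set a := A k n m; set b := delay (A k n) m; set c := delay _ n; set d := delay _ n.
set p := delay _ k => H.
apply/eqP; rewrite -subr_eq0; apply/eqP.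
transitivity (a - q * b - q * c + q ^+ 2 * d -
 (((k == 0%N) && (n == 0%N) && (m == 0%N))%:R + q * (a - b - c + d + p))); first by ring.
by rewrite H subrr.
Qed.

End WeightedSum.

(* Coefficient of [z ^ n] in [z ^ l (1 - z) ^ k]. *)
Definition shifted_sign_bin (R : pzRingType) (k n l : nat) : R :=
  if (l <= n)%N then (-1) ^+ (n - l) * 'C(k, n - l)%:R else 0.

(* Coefficient of [z ^ n w ^ m] in [((1 - z) (1 - w)) ^ k / (1 - q z w) ^ k.+1]. *)
Definition gram_coef (R : pzRingType) (q : R) (k n m : nat) : R :=
  \sum_(l < n.+1) shifted_sign_bin R k n l * shifted_sign_bin R k m l
     * ('C(l + k, k)%:R * q ^+ l).

Section GramCoef.
Variables (R : comNzRingType) (q : R).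
Local Notation u := (shifted_sign_bin R).
Local Notation T := (gram_coef q).

Lemma shifted_sign_bin_gt k n l : (n < l)%N -> u k n l = 0.
Proof. by rewrite ltnNge /shifted_sign_bin => /negbTE ->. Qed.

Lemma shifted_sign_binSS k n l : u k n.+1 l.+1 = u k n l.
Proof. by rewrite /shifted_sign_bin ltnS subSS. Qed.

Lemma shifted_sign_binS k n l : u k.+1 n l = u k n l - delay (fun n' => u k n' l) n.
Proof.
rewrite /shifted_sign_bin; case: n => [|n] /=.
  by case: l => [|l] /=; rewrite ?bin0 subr0.
have [ln|] := leqP l n; first by rewrite leqW // subSn // binS natrD exprS; ring.
rewrite leq_eqVlt => /orP[/eqP <-|nl]; first by rewrite leqnn subnn !bin0 subr0.
by rewrite (leqNgt l n.+1) nl subr0.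
Qed.

Lemma gram_coef_widen k n m B : (n < B)%N ->
  T k n m = \sum_(l < B) u k n l * u k m l * ('C(l + k, k)%:R * q ^+ l).
Proof.
move=> nB; rewrite /gram_coef (big_ord_widen B
  (fun l => u k n l * u k m l * ('C(l + k, k)%:R * q ^+ l))) //.
rewrite big_mkcond /=; apply: eq_bigr => l _.
by case: ltnP => // /shifted_sign_bin_gt ->; rewrite !mul0r.
Qed.

Lemma gram_coef_k0 n m : T 0 n m = (n == m)%:R * q ^+ n.
Proof.
have uE a b : u 0 a b = (a == b)%:R.
  rewrite /shifted_sign_bin bin0n subn_eq0; have [|] := leqP b a.
    by rewrite leq_eqVlt => /orP[/eqP ->|ba];
      rewrite ?eqxx ?leqnn ?subnn ?mul1r // leqNgt ba gtn_eqF // mulr0.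
  by move=> ab; rewrite ltn_eqF.
rewrite /gram_coef (bigD1 ord_max) //= big1 ?addr0 => [|i].
  by rewrite !uE eqxx mul1r bin0 mul1r eq_sym.
by rewrite -val_eqE /= uE eq_sym => /negbTE ->; rewrite !mul0r.
Qed.

Lemma gram_coef_0 n m :
  T 0 n m - q * delay (fun n' => delay (T 0 n') m) n = ((n == 0%N) && (m == 0%N))%:R.
Proof.
case: n m => [|n] [|m] /=; rewrite !gram_coef_k0 ?mul0r ?mulr0 ?subr0 ?mul1r //.
by rewrite eqSS exprS mulrCA subrr.
Qed.

(** Both sides are coefficients of [((1 - z) (1 - w) / (1 - q z w)) ^ k.+1]: on the left one
    denominator factor is cancelled by Pascal's rule, on the right one numerator factor is
    expanded. *)
Lemma gram_coefS k n m :
  T k.+1 n m - q * delay (fun n' => delay (T k.+1 n') m) n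
  = T k n m - delay (T k n) m - delay (fun n' => T k n' m) n
    + delay (fun n' => delay (T k n') m) n.
Proof.
transitivity (\sum_(l < n.+1) u k.+1 n l * u k.+1 m l * ('C(l + k, k)%:R * q ^+ l)).
  have base l0 : 'C(l0 + k.+1, k.+1) = ('C(l0 + k, k.+1) + 'C(l0 + k, k))%N.
    by rewrite addnS binS.
  rewrite /gram_coef.
  under eq_bigr do rewrite base natrD addrC mulrDl mulrDr.
  rewrite big_split /= -addrA [X in _ + X](_ : _ = 0) ?addr0 //.
  apply/eqP; rewrite subr_eq0; apply/eqP.
  rewrite big_ord_recl add0n bin_small // mul0r mulr0 add0r.
  under eq_bigr do rewrite lift0.
  case: n m => [|n] [|m] /=; rewrite ?big_ord0 ?mulr0 //.
    by rewrite big1 // => i _; rewrite (@shifted_sign_bin_gt _ 0) // mulr0 mul0r.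
  rewrite mulr_sumr; apply: eq_bigr => i _; rewrite !shifted_sign_binSS addSnnS exprS.
  ring.
rewrite [LHS](eq_bigr (fun l : 'I_n.+1 =>
    (u k n l * u k m l - u k n l * delay (fun m' => u k m' l) m
     - delay (fun n' => u k n' l) n * u k m l
     + delay (fun n' => u k n' l) n * delay (fun m' => u k m' l) m)
    * ('C(l + k, k)%:R * q ^+ l))); last first.
  by move=> l _; rewrite !shifted_sign_binS; congr (_ * _); ring.
under eq_bigr do rewrite mulrDl !mulrBl.
rewrite big_split !sumrB /=; congr (_ - _ - _ + _).
- case: m => [|m] //=; rewrite big1 // => i _; by rewrite mulr0 mul0r.
- case: n => [|n] /=; first by rewrite big1 // => i _; rewrite !mul0r.
  by rewrite (@gram_coef_widen _ n _ n.+2).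
case: n => [|n] /=; first by rewrite big1 // => i _; rewrite !mul0r.
case: m => [|m] /=; first by rewrite big1 // => i _; rewrite mulr0 mul0r.
by rewrite (@gram_coef_widen _ n _ n.+2).
Qed.

(** On the diagonal the signs are squared away; [i] stands for [n - l]. *)
Lemma gram_coef_diag k n :
  T k n n = \sum_(i < n.+1) ('C(k, i) ^ 2)%:R * ('C(n - i + k, k)%:R * q ^+ (n - i)).
Proof.
rewrite /gram_coef (reindex_inj rev_ord_inj) /=; apply: eq_bigr => i _.
rewrite subSS /shifted_sign_bin leq_subr subKn -1?ltnS //.
by congr (_ * _); rewrite mulrACA -exprMn mulrNN mulr1 expr1n mul1r -natrM.
Qed.

End GramCoef.

(** Both sides satisfy the recursion of [meixner_gram_rec], which has a unique solution. *)
Lemma meixner_gramE (R : realType) (q : R) (q0 : 0 < q) (q1 : q < 1) (k n m : nat) :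
  meixner_gram q k n m = q ^+ k / (1 - q) ^+ k.+1 * gram_coef q k n m.
Proof.
have q1' : 1 - q != 0 by rewrite subr_eq0 eq_sym lt_eqF.
pose c k : R := q ^+ k / (1 - q) ^+ k.+1.
have c0 : (1 - q) * c 0%N = 1 by rewrite /c expr0 expr1 mul1r mulfV.
have cS k' : (1 - q) * c k'.+1 = q * c k'.
  by rewrite /c exprS [in RHS]mulrA (exprS (1 - q)) invfM mulrCA [X in _ * X]mulrA divff // mul1r.
have delayZ (F : nat -> R) a i : delay (fun i' => a * F i') i = a * delay F i.
  by case: i => [|i] //=; rewrite mulr0.
have delay2 (F : nat -> nat -> R) a i j :
    delay (fun i' => delay (fun j' => a * F i' j') j) i
    = a * delay (fun i' => delay (F i') j) i.
  by case: i j => [|i] [|j] //=; rewrite mulr0.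
(* For fixed [k'] the delayed term has first index [n - 1], so induction on [n] and cancelling
   [1 - q] give uniqueness. *)
suff H k' : (forall n m, (1 - q) * (meixner_gram q k' n m
      - q * delay (fun n' => delay (meixner_gram q k' n') m) n)
    = (1 - q) * (c k' * gram_coef q k' n m
      - q * delay (fun n' => delay (fun m' => c k' * gram_coef q k' n' m') m) n)) ->
    forall n m, meixner_gram q k' n m = c k' * gram_coef q k' n m.
  elim: k n m => [|k IHk]; apply: H => n m; rewrite meixner_gram_rec //=.
    rewrite mulr0 addr0.
    by rewrite delay2 mulrCA -mulrBr mulrA c0 mul1r gram_coef_0.
  rewrite add0r delay2 [q * (c _ * _)]mulrCA -mulrBr mulrA cS gram_coefS.
  have E : meixner_gram q k = fun i j => c k * gram_coef q k i j.
    by apply/funext => i; apply/funext => j; exact: IHk.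
  by rewrite E delay2 !delayZ -[RHS]mulrA; congr (_ * _); rewrite mulrDr !mulrBr.
move=> {n m} E; elim=> [|n IH] m.
  by move: (mulfI q1' (E 0%N m)); rewrite /= !mulr0 !subr0.
move: (mulfI q1' (E n.+1 m)).
by case: m => [|m] /=; rewrite ?mulr0 ?subr0 // IH => /addIr.
Qed.

(** * The ensemble sum *)

(** Each Meixner polynomial is a combination of the binomials [C(h, a)] up to its degree, so the
    change of basis [U] is triangular with powers of [q - 1] on the diagonal. *)
Lemma det_meixner_bin (R : comNzRingType) (q : R) (n : nat) (l : nat -> nat) :
  \det (\matrix_(i < n, j < n) meixner q (n - j.+1) (l i + (n - i.+1)))
  = \det (bin_matrix R n l) * \prod_(j < n) (q - 1) ^+ j.
Proof.
pose U : 'M[R]_n := \matrix_(i, j)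
  ('C(n - j.+1, n - i.+1)%:R * (q ^+ ((n - j.+1) - (n - i.+1)) * (q - 1) ^+ (n - i.+1))).
have -> : \matrix_(i < n, j < n) meixner q (n - j.+1) (l i + (n - i.+1)) = bin_matrix R n l *m U.
  apply/matrixP => i j; rewrite !mxE /meixner.
  set h := (l i + _)%N; set d := (n - j.+1)%N.
  have dn : (d.+1 <= n)%N by rewrite /d; have := ltn_ord j; lia.
  rewrite (big_ord_widen n (fun a => ('C(d, a) * 'C(h, a))%:R * (q ^+ (d - a) * (q - 1) ^+ a))) //.
  rewrite big_mkcond (reindex_inj rev_ord_inj) /=; apply: eq_bigr => a _.
  rewrite !mxE /= -/h -/d; case: ltnP => [_|da].
    by rewrite natrM mulrAC mulrC mulrA mulrAC -!mulrA.
  by rewrite (@bin_small d) // mul0r mulr0.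
rewrite det_mulmx; congr (_ * _); rewrite det_trig; last first.
  apply/is_trig_mxP => i j ij; rewrite mxE bin_small ?mul0r //.
  by have := ltn_ord i; have := ltn_ord j; lia.
rewrite [RHS](reindex_inj rev_ord_inj); apply: eq_bigr => i _.
by rewrite mxE binn subnn expr0 !mul1r.
Qed.

(** A permutation with a nonzero term fixes every index other than [m], hence also [m]. *)
Lemma det_diag_replace_row (R : comNzRingType) (N : nat) (m : 'I_N) (d r : 'I_N -> R) :
  \det (\matrix_(i, j) if i == m then r j else (i == j)%:R * d i)
  = r m * \prod_(i | i != m) d i.
Proof.
rewrite /determinant (bigD1 1%g) //= odd_perm1 expr0 mul1r [X in _ + X]big1 ?addr0.
  rewrite (bigD1 m) //= mxE eqxx perm1; congr (_ * _).
  by apply: eq_bigr => i /negbTE im; rewrite mxE im perm1 eqxx mul1r.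
move=> s; apply: contraNeq => H; apply/eqP/permP => i; rewrite perm1.
have fixi j : j != m -> s j = j.
  move=> jm; apply/eqP; rewrite eq_sym; apply: contraNT H => sj.
  by rewrite (bigD1 j) //= mxE (negbTE jm) (negbTE sj) !mul0r mulr0.
have [->|/fixi //] := eqVneq i m.
apply/eqP; apply: contraNT H => sm.
by have := fixi _ sm => /perm_inj e; rewrite e eqxx in sm.
Qed.

Lemma cvg_sumn (R : realType) (I : Type) (r : seq I) (F : I -> nat -> R) (l : I -> R) :
  (forall i, F i M @[M --> \oo] --> l i) ->
  \sum_(i <- r) F i M @[M --> \oo] --> \sum_(i <- r) l i.
Proof.
move=> H; elim: r => [|i r IH].
  by rewrite big_nil; under eq_fun do rewrite big_nil; exact: cvg_cst.
by rewrite big_cons; under eq_fun do rewrite big_cons; apply: cvgD.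
Qed.

Lemma cvg_prodn (R : realType) (I : Type) (r : seq I) (F : I -> nat -> R) (l : I -> R) :
  (forall i, F i M @[M --> \oo] --> l i) ->
  \prod_(i <- r) F i M @[M --> \oo] --> \prod_(i <- r) l i.
Proof.
move=> H; elim: r => [|i r IH].
  by rewrite big_nil; under eq_fun do rewrite big_nil; exact: cvg_cst.
by rewrite big_cons; under eq_fun do rewrite big_cons; apply: cvgM.
Qed.

Lemma cvg_det (R : realType) (N : nat) (F : 'I_N -> 'I_N -> nat -> R) (l : 'I_N -> 'I_N -> R) :
  (forall i j, F i j M @[M --> \oo] --> l i j) ->
  \det (\matrix_(i, j) F i j M) @[M --> \oo] --> \det (\matrix_(i, j) l i j).
Proof.
move=> H; rewrite /determinant; apply: cvg_sumn => s; apply: cvgM; first exact: cvg_cst.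
rewrite (_ : (fun M => _) = fun M => \prod_i F i (s i) M); last first.
  by apply/funext => M; apply: eq_bigr => i _; rewrite mxE.
under eq_bigr do rewrite mxE.
exact: cvg_prodn.
Qed.

(** Cauchy-Binet yields determinants whose entries are truncated moments. In the limit,
    orthogonality makes every row except row [m] diagonal, and row [m] carries the moments of order
    [k]. *)
Lemma cvg_decreasing_sum (R : realType) (q : R) (q0 : 0 < q) (q1 : q < 1) (N k : nat) :
  (\sum_(s : {ffun 'I_N -> 'I_M} | decreasing_ffun s)
     (\sum_i ((s i) ^_ k)%:R) * (\prod_i q ^+ s i)
     * \det (\matrix_(i, j < N) meixner q (N - j.+1) (s i)) ^+ 2) @[M --> \oo]
  --> \sum_(n < N) k`!%:R * meixner_gram q k n n
        * \prod_(i < N | i != n) (q ^+ i / (1 - q)).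
Proof.
pose P (i : 'I_N) := meixner q (N - i.+1).
have Ppb i : poly_bounded (P i) by exact: poly_bounded_meixner.
rewrite (_ : (fun M => _) = fun M => \sum_(m < N) \det (\matrix_(i, j)
    \sum_(0 <= x < M) (if i == m then (x ^_ k)%:R else 1) * q ^+ x * P i x * P j x)); last first.
  apply/funext => M.
  rewrite (cauchy_binet_insertion (fun j x => P j x) (fun x => (x ^_ k)%:R) (fun x => q ^+ x)).
  apply: eq_bigr => m _; congr (\det _); apply/matrixP => i j; rewrite !mxE.
  by rewrite big_mkord.
(* Index [j] carries degree [N - j - 1], whence the reversal. *)
rewrite (reindex_inj rev_ord_inj) /=; apply: cvg_sumn => m.
pose r j := k`!%:R * meixner_gram q k (N - m.+1) (N - j.+1).
rewrite (_ : k`!%:R * _ * _ = \det (\matrix_(i, j)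
    if i == m then r j else (i == j)%:R * (q ^+ (N - i.+1) / (1 - q)))).
  apply: cvg_det => i j; case: eqP => [->|_].
    rewrite /r (_ : (fun M => _) = fun M =>
        k`!%:R * series (fun h => 'C(h, k)%:R * (P m h * P j h) * q ^+ h) M).
      by apply: cvgMl_tmp; apply: weighted_sum_cvg => //; exact: poly_boundedM.
    apply/funext => M; rewrite /series /= mulr_sumr; apply: eq_bigr => x _.
    by move: (P m x) (P j x) (q ^+ x) => a b c; rewrite -bin_ffact natrM; ring.
  have -> : (i == j)%:R * (q ^+ (N - i.+1) / (1 - q)) = meixner_gram q 0 (N - i.+1) (N - j.+1).
    rewrite meixner_gramE // gram_coef_k0 expr0 expr1 mul1r mulrCA [_^-1 * _]mulrC.
    by rewrite -(inj_eq (@rev_ord_inj N) i j) -val_eqE mulrCA mulrA.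
  rewrite (_ : (fun M => _) = series (fun h => 'C(h, 0)%:R * (P i h * P j h) * q ^+ h)).
    by apply: weighted_sum_cvg => //; exact: poly_boundedM.
  apply/funext => M; rewrite /series /=; apply: eq_bigr => x _.
  by move: (P i x) (P j x) (q ^+ x) => a b c; rewrite bin0; ring.
rewrite det_diag_replace_row /r; congr (_ * _).
rewrite (reindex_inj rev_ord_inj) /=; apply: eq_bigl => i.
by rewrite (inj_eq (@rev_ord_inj N)).
Qed.

(** * Partitions as strictly decreasing sequences *)

Lemma nth_filter_gt0 (l : seq nat) (i : nat) :
  sorted geq l -> nth 0%N [seq x <- l | (0 < x)%N] i = nth 0%N l i.
Proof.
have tr : transitive geq by move=> a b c /= ab bc; apply: leq_trans bc ab.
elim: l i => // x l IH i xl; have := order_path_min tr xl; move/path_sorted: xl => sl /=.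
case: x => [|x] /= le; last by case: i => [|i] //=; exact: IH.
have -> : [seq y <- l | (0 < y)%N] = [::].
  apply/eqP; rewrite -size_eq0 size_filter -leqn0 leqNgt -has_count -all_predC.
  by apply: sub_all le => y /=; rewrite leqn0 => /eqP ->.
rewrite nth_nil; case: i => [|i] //=; apply/esym.
have [il|] := ltnP i (size l); last by move/(nth_default 0%N).
by move/(all_nthP 0%N): le => /(_ i il); rewrite /= leqn0 => /eqP.
Qed.

Lemma is_partition_eq (la mu : seq nat) :
  is_partition la -> is_partition mu -> (forall i, nth 0%N la i = nth 0%N mu i) -> la = mu.
Proof.
move=> pla pmu E; apply: (@eq_from_nth _ 0%N) => [|i _]; last exact: E.
case: (ltngtP (size la) (size mu)) => //.
  by move/(is_partition_gt0 pmu); rewrite -E nth_default.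
by move/(is_partition_gt0 pla); rewrite E nth_default.
Qed.

(** It makes the subtraction that recovers the parts from [s] exact. *)
Lemma decreasing_ffun_ge (N M : nat) (s : {ffun 'I_N -> 'I_M}) :
  decreasing_ffun s -> forall i : 'I_N, (N - i.+1 <= s i)%N.
Proof.
move=> /decreasing_ffunP sd.
suff H d (i : 'I_N) : (i + d.+1 = N)%N -> (d <= s i)%N.
  by move=> i; apply: H; have := ltn_ord i; lia.
elim: d i => // d IH i E.
have iN : (i.+1 < N)%N by lia.
have e : (Ordinal iN + d.+1 = N)%N by rewrite /= addSnnS.
exact: leq_ltn_trans (IH _ e) (sd i (Ordinal iN) (leqnn _)).
Qed.

Lemma decreasing_ffun_partition (N M : nat) (s : {ffun 'I_N -> 'I_M}) :
  decreasing_ffun s ->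
  exists la, [/\ is_partition la, (size la <= N)%N &
    forall i : 'I_N, s i = (nth 0%N la i + (N - i.+1))%N :> nat].
Proof.
move=> sd; have sge := decreasing_ffun_ge sd; move/decreasing_ffunP: sd => sd.
pose l := mkseq (fun i => ffun_ext s i - (N - i.+1))%N N.
have sl : sorted geq l.
  apply/(sortedP 0%N) => i; rewrite size_mkseq => iN.
  rewrite (nth_mkseq _ _ iN) (nth_mkseq _ _ (ltnW iN)) /=.
  have := sd (Ordinal (ltnW iN)) (Ordinal iN) (leqnn _).
  by have := ffun_extE s (Ordinal iN); have := ffun_extE s (Ordinal (ltnW iN)) => /= -> ->; lia.
exists [seq x <- l | (0 < x)%N]; split.
- rewrite /is_partition sorted_filter //=; last first.
    by move=> a b c /= ab bc; apply: leq_trans bc ab.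
  by rewrite mem_filter.
- by rewrite size_filter (leq_trans (count_size _ _)) // size_mkseq.
by move=> i; rewrite nth_filter_gt0 // nth_mkseq // ffun_extE subnK.
Qed.

Lemma esum_finType (R : realType) (T : finType) (P : pred T) (f : T -> R) :
  (forall s, P s -> 0 <= f s) ->
  (\esum_(s in [set s | P s]) (f s)%:E = (\sum_(s | P s) f s)%:E)%E.
Proof.
move=> f0; rewrite esum_fset; last 2 first.
- exact: finite_finset.
- by move=> s; rewrite inE lee_fin => /f0.
rewrite (fsbigE (enum P)) ?enum_uniq //; last 2 first.
- by move=> s /=; rewrite mem_enum.
- by move=> s /= Ps; rewrite mem_enum => /negP; case.
rewrite -sumEFin big_enum_cond; apply: eq_bigl => s.
by apply/andP/idP => [[]//|Ps]; split; [exact: Ps|exact: mem_set].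
Qed.

(** The partitions with at most [L.+1] parts are exhausted by the sets [E M], each in bijection with
    the decreasing sequences below [M.+1]. As the terms are nonnegative, the unordered sum is the
    limit of these finite sums. *)
Lemma esum_partition (R : realType) (L : nat) (a : seq nat -> R)
    (b : forall M, {ffun 'I_L.+1 -> 'I_M} -> R) (l : R) :
  (forall la, is_partition la -> 0 <= a la) ->
  (forall la, is_partition la -> (L.+1 < size la)%N -> a la = 0) ->
  (forall M (s : {ffun 'I_L.+1 -> 'I_M}) la, is_partition la -> (size la <= L.+1)%N ->
     (forall i : 'I_L.+1, s i = (nth 0%N la i + (L.+1 - i.+1))%N :> nat) -> b M s = a la) ->
  (\sum_(s : {ffun 'I_L.+1 -> 'I_M} | decreasing_ffun s) b M s) @[M --> \oo] --> l ->
  (\esum_(la in [set la : seq nat | is_partition la]) (a la)%:E = l%:E)%E.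
Proof.
move=> a0 aout ba bl.
(* The cutoff is [M.+1] so that [inord] has a target. *)
pose B M := \sum_(s : {ffun 'I_L.+1 -> 'I_M.+1} | decreasing_ffun s) b M.+1 s.
have Bl : B @ \oo --> l.
  by rewrite (cvg_shiftS (fun M =>
    \sum_(s : {ffun 'I_L.+1 -> 'I_M} | decreasing_ffun s) b M s)).
pose E M := [set la : seq nat | [/\ is_partition la, (size la <= L.+1)%N
  & (nth 0%N la 0 + L < M.+1)%N]].
have EB M : (\esum_(la in E M) (a la)%:E = (B M)%:E)%E.
  rewrite -esum_finType; last first.
    by move=> s /decreasing_ffun_partition[la [pla sla /(ba _ _ _ pla sla) ->]]; exact: a0.
  pose e (la : seq nat) : {ffun 'I_L.+1 -> 'I_M.+1} :=
    [ffun i : 'I_L.+1 => inord (nth 0%N la i + (L.+1 - i.+1))].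
  have eE la : E M la -> forall i : 'I_L.+1,
      e la i = (nth 0%N la i + (L.+1 - i.+1))%N :> nat.
    move=> [pla _ ltM] i; rewrite ffunE inordK //; apply: leq_ltn_trans ltM.
    apply: leq_add; last by rewrite subSS leq_subr.
    exact: (@antitone_leq (nth 0%N la) (is_partition_antitone pla)).
  rewrite (reindex_esum (E M) _ e).
    by apply: eq_esum => la Ela; case: (Ela) => pla sla _; rewrite (ba _ _ la) //; exact: eE.
  split.
  - move=> la Ela; apply/decreasing_ffunP => i j ij; rewrite !(eE _ Ela).
    have [pla _ _] := Ela; rewrite -addnS; apply: leq_add.
      exact: (@antitone_leq (nth 0%N la) (is_partition_antitone pla) i j (ltnW ij)).
    by have := ltn_ord j; lia.
  - move=> la mu; rewrite !inE => Ela Emu elm; have [pla sla _] := Ela; have [pmu smu _] := Emu.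
    apply: is_partition_eq => // i; have [iL|Li] := ltnP i L.+1; last first.
      by rewrite !nth_default // ?(leq_trans sla) ?(leq_trans smu).
    have := eE _ Ela (Ordinal iL); rewrite elm (eE _ Emu) => /eqP.
    by rewrite eqn_add2r => /eqP.
  - move=> s /decreasing_ffun_partition[la [pla sla sE]]; exists la.
      split => //; have := sE ord0; rewrite /= subn1 /= => <-.
      exact: ltn_ord.
    apply/ffunP => i; rewrite ffunE; apply/val_inj.
    by rewrite /= -sE inord_val.
have Bnd : nondecreasing_seq B.
  move=> M M' MM'; rewrite -lee_fin -!EB esum_mkcond [leRHS]esum_mkcond.
  apply: le_esum => la _; case: ifPn => [|_]; last first.
    by case: ifPn => //; rewrite inE lee_fin => -[pla _ _]; exact: a0.
  rewrite inE => -[pla sla lt]; rewrite ifT // inE; split => //.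
  by apply: leq_trans lt _; rewrite ltnS.
have Ble M : B M <= l.
  by rewrite -(cvg_lim _ Bl) //; apply: nondecreasing_cvgn_le => //; exact: cvgP Bl.
apply/eqP; rewrite eq_le; apply/andP; split; last first.
  have : (EFin \o B) @ \oo --> l%:E by apply: cvg_EFin => //; exact: nearW.
  move=> /cvg_lim <- //; apply: lime_le; first by apply/cvgP; apply: cvg_EFin Bl; exact: nearW.
  apply: nearW => M; rewrite /= -EB esum_mkcond [leRHS]esum_mkcond.
  apply: le_esum => la _; case: ifPn => [|_].
    by rewrite inE => -[pla _ _]; rewrite ifT // inE.
  by case: ifPn => //; rewrite inE lee_fin => /a0.
apply: ge_ereal_sup => /= _ [X [finX XP] <-].
rewrite -esum_fset //; last by move=> la; rewrite inE lee_fin => /XP/a0.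
have [r Xr] := (finite_seqP _).1 finX.
(* A crude cutoff: the sum dominates each of its terms, so [E M] contains every member of [X] with
   at most [L.+1] parts. *)
pose M := (\sum_(la <- r) (nth 0%N la 0 + L))%N.
apply: le_trans (_ : (B M)%:E <= _)%E; last by rewrite lee_fin.
rewrite -EB esum_mkcond [leRHS]esum_mkcond.
apply: le_esum => la _; case: ifPn => [|_]; last first.
  by case: ifPn => //; rewrite inE lee_fin => -[pla _ _]; exact: a0.
rewrite inE => Xla; have pla := XP _ Xla.
case: (leqP (size la) L.+1) => sla; last by rewrite aout //; case: ifP.
rewrite ifT // inE; split => //; rewrite ltnS /M.
by move: Xla; rewrite Xr /= => lar; rewrite (big_rem la) //= leq_addr.
Qed.

(** * Finite sums and the hypergeometric polynomial *)

Lemma sumn_nth (la : seq nat) (N : nat) : (size la <= N)%N ->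
  sumn la = (\sum_(i < N) nth 0%N la i)%N.
Proof.
move=> sN; rewrite sumnE (big_nth 0%N) big_mkord (big_ord_widen N (nth 0%N la)) //.
rewrite big_mkcond; apply: eq_bigr => i _; case: ltnP => //= H.
by rewrite nth_default.
Qed.

(** Source of the normalisation [(1 - q) ^ (N ^ 2)]: the squared column factor gives the exponent
    [N (N - 1)], and the [N] squared norms give the remaining [N]. *)
Lemma prod_sub1_pow_sqr (R : comNzRingType) (q : R) (n : nat) :
  (\prod_(j < n) (q - 1) ^+ j) ^+ 2 * (1 - q) ^+ n = (1 - q) ^+ (n ^ 2).
Proof.
elim: n => [|n IH]; first by rewrite big_ord0 expr1n mulr1.
have E : ((q - 1) ^+ n) ^+ 2 = (1 - q) ^+ n * (1 - q) ^+ n.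
  by rewrite exprAC -opprB sqrrN exprAC expr2.
have -> : (n.+1 ^ 2 = n ^ 2 + n + n.+1)%N by lia.
rewrite big_ord_recr /= exprMn E !exprD -IH exprS; ring.
Qed.

Lemma sum_bin_triangle (R : comNzRingType) (g : nat -> R) (k N : nat) :
  \sum_(n < N) \sum_(i < n.+1) g i * ('C(n - i + k, k))%:R
  = \sum_(i < N) g i * ('C(N - i + k, k.+1))%:R.
Proof.
elim: N => [|N IH]; first by rewrite !big_ord0.
rewrite big_ord_recr /= IH [in RHS]big_ord_recr /= [X in _ + X = _]big_ord_recr /=.
rewrite addrA -big_split /=; congr (_ + _); last by rewrite subSn // subnn !binn.
apply: eq_bigr => i _; rewrite -mulrDr -natrD.
by rewrite subSn 1?ltnW // addSn binS.
Qed.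

(** Partial sums of a Cauchy product with a finitely supported factor. For [i >= M] the truncated
    [M - i] is 0 and the empty partial sum vanishes, as it should. *)
Lemma sum_cauchy_product_series (R : comNzRingType) (a b : nat -> R) (k M : nat) :
  (forall i, (k < i)%N -> a i = 0) ->
  \sum_(L < M) \sum_(i < L.+1) a i * b (L - i)%N
  = \sum_(i < k.+1) a i * series b (M - i)%N.
Proof.
move=> a0; elim: M => [|M IH].
  by rewrite big_ord0 big1 // => i _; rewrite /series /= big_geq ?mulr0.
rewrite big_ord_recr /= IH.
rewrite (big_ord_widen (maxn M.+1 k.+1) (fun i => a i * b (M - i)%N)) ?leq_maxl //.
pose F i := a i * (if (i <= M)%N then b (M - i)%N else 0).
have -> : \sum_(i < maxn M.+1 k.+1 | (i < M.+1)%N) a i * b (M - i)%N = \sum_(i < k.+1) F i.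
  rewrite (big_ord_widen (maxn M.+1 k.+1) F) ?leq_maxr // big_mkcond [RHS]big_mkcond.
  apply: eq_bigr => i _; rewrite /F !ltnS.
  by case: (leqP i M) => iM; case: (leqP i k) => ik; rewrite ?mulr0 // a0 // mul0r.
rewrite -big_split /=; apply: eq_bigr => i _; rewrite /F -mulrDr; congr (_ * _).
case: leqP => iM; first by rewrite subSn // seriesSr.
by rewrite addr0 (eqP iM) (eqP (ltnW iM)).
Qed.

Lemma rising_fact_opp_nat (R : realType) (k i : nat) :
  rising_fact (- k%:R : R) i = (-1) ^+ i * (k ^_ i)%:R.
Proof.
rewrite /rising_fact; elim: i => [|i IH]; first by rewrite big_ord0 mulr1.
rewrite big_ord_recr /= IH ffactnSr natrM exprS; have [ik|ki] := leqP i k.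
  by rewrite natrB //; ring.
by rewrite ffact_small //; ring.
Qed.

Lemma rising_fact1 (R : realType) (i : nat) : rising_fact (1 : R) i = i`!%:R.
Proof.
rewrite /rising_fact; elim: i => [|i IH]; first by rewrite big_ord0.
by rewrite big_ord_recr /= IH factS natrM mulrC -nat1r.
Qed.

(** The rising factorials of [- k] have equal signs that cancel, and their quotients by [i!] are
    [C(k, i)]; the partial sums are constant beyond [k]. *)
Lemma hyp2F1_opp_nat (R : realType) (k : nat) (t : R) :
  hyp2F1 (- k%:R) (- k%:R) 1 t = \sum_(i < k.+1) ('C(k, i) ^ 2)%:R * t ^+ i.
Proof.
rewrite /hyp2F1.
rewrite (_ : (fun i => _) = fun i => ('C(k, i) ^ 2)%:R * t ^+ i); last first.
  apply/funext => i; rewrite rising_fact_opp_nat rising_fact1 -bin_ffact.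
  have f0 : i`!%:R != 0 :> R by rewrite pnatr_eq0 -lt0n fact_gt0.
  rewrite [X in X / _](_ : _ = ('C(k, i) * i`!)%:R ^+ 2); last first.
    by rewrite mulrACA -exprMn mulrNN mulr1 expr1n mul1r expr2.
  by rewrite natrM natrX; field.
apply: lim_near_cst => //; near=> M.
have kM : (k < M)%N by near: M; exists k.+1.
rewrite /series /= (big_ord_widen M (fun i => ('C(k, i) ^ 2)%:R * t ^+ i)) // big_mkord.
rewrite [RHS]big_mkcond; apply: eq_bigr => i _; case: ltnP => // ki.
by rewrite bin_small // mul0r.
Unshelve. all: by end_near.
Qed.

Lemma esum_schur_moment (R : realType) (q t : R) (k L : nat)
    (q0 : 0 < q) (q1 : q < 1) (t0 : 0 < t) :
  (\esum_(la in [set la : seq nat | is_partition la])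
       (L.+1%:R * part_moment R L.+1 k la * (1 - q) ^+ (L.+1 ^ 2) * q ^+ sumn la
         * (t * q) ^+ L * schur la (fun _ : 'I_L.+1 => 1 : R) ^+ 2)%:E
  = (q ^+ k * k`!%:R / (1 - q) ^+ k * \sum_(i < L.+1)
      ('C(k, i) ^ 2)%:R * t ^+ i * ('C(L - i + k.+1, k.+1)%:R * (t * q) ^+ (L - i)))%:E)%E.
Proof.
have q1' : 1 - q != 0 by rewrite subr_eq0 eq_sym lt_eqF.
have qn0 n : q ^+ n != 0 by rewrite expf_neq0 // gt_eqF.
(* [Q] accounts for the weight [q ^ h] exceeding [q ^ |la|]: the [h_i] sum to [|la|] plus the sum of
   the [j] below [N]. *)
pose Q := \prod_(j < L.+1) q ^+ j.
have Q0 : Q != 0 by apply/prodf_neq0 => j _; exact: qn0.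
pose c := (t * q) ^+ L * (1 - q) ^+ L.+1 / Q.
pose b M (s : {ffun 'I_L.+1 -> 'I_M}) : R :=
  c * ((\sum_i ((s i) ^_ k)%:R) * (\prod_i q ^+ s i)
     * \det (\matrix_(i, j < L.+1) meixner q (L.+1 - j.+1) (s i)) ^+ 2).
apply: (esum_partition (b := b)).
- move=> la _; apply: mulr_ge0; last exact: sqr_ge0.
  have pm : 0 <= part_moment R L.+1 k la.
    by apply: mulr_ge0; [rewrite invr_ge0|exact: sumr_ge0].
  have p1 n : 0 <= (1 - q) ^+ n by rewrite exprn_ge0 // subr_ge0 ltW.
  have p2 n : 0 <= q ^+ n by rewrite exprn_ge0 // ltW.
  have p3 n : 0 <= (t * q) ^+ n by rewrite exprn_ge0 // mulr_ge0 // ltW.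
  by move: (part_moment _ _ _ _) pm => p pm; rewrite !mulr_ge0.
- by move=> la pla Lla; rewrite schur_oversize // expr0n mulr0.
- move=> M s la pla sla sE; rewrite schur_det // /b.
  rewrite (_ : \matrix_(i, j) meixner q (L.+1 - j.+1) (s i)
    = \matrix_(i < L.+1, j < L.+1)
        meixner q (L.+1 - j.+1) (nth 0%N la i + (L.+1 - i.+1))); last first.
    by apply/matrixP => i j; rewrite !mxE sE.
  rewrite det_meixner_bin exprMn /part_moment mulVKf ?pnatr_eq0 //.
  have -> : \sum_i ((s i) ^_ k)%:R
      = \sum_(i < L.+1) ((nth 0%N la i + (L.+1 - i.+1)) ^_ k)%:R :> R.
    by apply: eq_bigr => i _; rewrite sE.
  have -> : \prod_i q ^+ s i = q ^+ sumn la * Q.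
    rewrite (sumn_nth sla) expr_sum /Q [X in _ * X](reindex_inj rev_ord_inj) -big_split /=.
    by apply: eq_bigr => i _; rewrite sE exprD.
  rewrite -prod_sub1_pow_sqr /c.
  move: (\sum_(i < L.+1) _) (\det _) (\prod_(j < L.+1) (q - 1) ^+ j)
    ((t * q) ^+ L) ((1 - q) ^+ L.+1) (q ^+ sumn la) => a1 a2 a3 a4 a5 a6.
  by field.
rewrite (_ : _ * _ = c * \sum_(n < L.+1) k`!%:R * meixner_gram q k n n
        * \prod_(i < L.+1 | i != n) (q ^+ i / (1 - q))).
  rewrite (_ : (fun M => _) = fun M => c * \sum_(s : {ffun 'I_L.+1 -> 'I_M} | decreasing_ffun s)
     (\sum_i ((s i) ^_ k)%:R) * (\prod_i q ^+ s i)
     * \det (\matrix_(i, j < L.+1) meixner q (L.+1 - j.+1) (s i)) ^+ 2).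
    by apply: cvgMl_tmp; exact: cvg_decreasing_sum.
  by apply/funext => M; rewrite mulr_sumr.
have exprB (x : R) a b' : (a <= b')%N -> x ^+ b' = x ^+ a * x ^+ (b' - a).
  by move=> ab; rewrite -exprD subnKC.
(* The middle expression sums the diagonal coefficients divided by [q ^ n]; [sum_bin_triangle]
   carries out the sum over [n]. *)
transitivity (q ^+ k * k`!%:R / (1 - q) ^+ k * (t * q) ^+ L * \sum_(n < L.+1) \sum_(i < n.+1)
   (('C(k, i) ^ 2)%:R / q ^+ i) * 'C(n - i + k, k)%:R).
  rewrite (sum_bin_triangle (fun i => ('C(k, i) ^ 2)%:R / q ^+ i)) -[RHS]mulrA.
  congr (_ * _); rewrite mulr_sumr; apply: eq_bigr => i _.
  have iL : (i <= L)%N by rewrite -ltnS.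
  rewrite subSn // addSnnS (exprB (t * q) _ _ iL) !exprMn.
  move: ('C(k, i) ^ 2)%:R ('C(_, _)%:R) (t ^+ (L - i)) (q ^+ (L - i)) (t ^+ i) (qn0 i) =>
    a1 a2 a3 a4 a5.
  move: (q ^+ i) => a6 a60; by field.
rewrite !mulr_sumr; apply: eq_bigr => n _; rewrite meixner_gramE // gram_coef_diag.
(* The omitted factor leaves [(1 - q) / q ^ n], the source of the division by [q ^ n]. *)
have -> : \prod_(i < L.+1 | i != n) (q ^+ i / (1 - q)) = Q / (1 - q) ^+ L.+1 * (1 - q) / q ^+ n.
  have : \prod_(i < L.+1) (q ^+ i / (1 - q)) = Q / (1 - q) ^+ L.+1.
    by rewrite big_split /= prodr_const card_ord exprVn.
  rewrite (bigD1 n) //= => <-.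
  by move: (\prod_(i < L.+1 | i != n) _) (q ^+ n) (qn0 n) => p' a a0; field; rewrite q1' a0.
rewrite (_ : \sum_(i < n.+1) ('C(k, i) ^ 2)%:R * ('C(n - i + k, k)%:R * q ^+ (n - i))
    = q ^+ n * \sum_(i < n.+1)
    (('C(k, i) ^ 2)%:R / q ^+ i) * 'C(n - i + k, k)%:R); last first.
  rewrite mulr_sumr; apply: eq_bigr => i _; have iL : (i <= n)%N by rewrite -ltnS.
  rewrite (exprB q _ _ iL).
  move: ('C(k, i) ^ 2)%:R ('C(_, _)%:R) (q ^+ (n - i)) (qn0 i) => a1 a2 a3.
  move: (q ^+ i) => a6 a60; by field.
rewrite /c; move: (\sum_(i < n.+1) _) => S; rewrite (exprS _ k).
have Z1 : (1 - q) ^+ k != 0 by rewrite expf_neq0.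
have Z2 : (1 - q) ^+ L.+1 != 0 by rewrite expf_neq0.
have := qn0 n.
move: ((1 - q) ^+ k) ((1 - q) ^+ L.+1) Z1 Z2 (q ^+ n) (q ^+ k) (k`!%:R) ((t * q) ^+ L) =>
  a1 a2 Z1 Z2 a3 a4 a5 a6 a30.
by field; rewrite q1' Z1 Z2 Q0 a30.
Qed.

Theorem corollary8 (R : realType) (q t : R) (k : nat)
    (hq0 : 0 < q) (hq1 : q < 1) (ht : 0 < t) (htq : t * q < 1) :
  (\sum_(1 <= N <oo)
     \esum_(la in [set la : seq nat | is_partition la])
       (N%:R * part_moment R N k la * (1 - q) ^+ (N ^ 2) * q ^+ sumn la
         * (t * q) ^+ (N - 1) * schur la (fun _ : 'I_N => 1 : R) ^+ 2)%:E)%E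
  = (q ^+ k * k`!%:R / ((1 - q) ^+ k * (1 - t * q) ^+ (k + 2))
      * hyp2F1 (- k%:R) (- k%:R) 1 t)%:E.
Proof.
pose c : R := q ^+ k * k`!%:R / (1 - q) ^+ k.
pose al i : R := ('C(k, i) ^ 2)%:R * t ^+ i.
pose be d : R := 'C(d + k.+1, k.+1)%:R * (t * q) ^+ d.
have x0 : 0 <= t * q by rewrite mulr_ge0 // ltW.
rewrite hyp2F1_opp_nat.
apply: cvg_lim => //; rewrite -cvg_shiftS /=.
(* With [N = L + 1], the sum over [N] is a Cauchy product of the finitely supported [al] with [be],
   so only the series of [be] remains infinite. *)
rewrite (_ : (fun M => _) = EFin \o (fun M => c * \sum_(i < k.+1) al i * series be (M - i)%N)).
  apply: cvg_EFin; first exact: nearW.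
  rewrite invfM mulrA -/c -mulrA mulr_sumr.
  apply: cvgMl_tmp; apply: cvg_sumn => i; rewrite -/(al i) mulrC.
  apply: cvgMl_tmp; rewrite cvg_centern addn2 -exprVn.
  exact: cvg_series_bin_geometric.
apply/funext => M /=; rewrite big_add1 /= -sum_cauchy_product_series; last first.
  by move=> i ki; rewrite /al bin_small // mul0r.
rewrite big_mkord mulr_sumr -sumEFin; apply: eq_bigr => L _.
by rewrite subn1 /= esum_schur_moment.
Qed.
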